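(* Let $\mathcal C$ be the set of all pointed Schreier graphs $(\Gamma,q)$ obtained from the Schreier graph $\Gamma$ of the action of $F$ on the orbit of $\frac12$ by choosing an arbitrary vertex $q$ as base vertex, and let $\overline{\mathcal C}$ be its closure in the space $\mathcal T$ of pointed marked graphs. Then the Cantor–Bendixson rank of $\overline{\mathcal C}$ is equal to $1$. The perfect kernel $\mathcal D$ of $\overline{\mathcal C}$ consists of the pointed graphs of types B and C described in the context, and $\mathcal D$ is homeomorphic to the Cantor set.
   Context: Thompson's group $F$ is the group of all strictly increasing piecewise linear homeomorphisms of $[0,1]$ that are differentiable except at finitely many dyadic rationals and whose slopes are integer powers of $2$; products are read left to right, $(fg)(x)=g(f(x))$, and $x^f:=f(x)$. It is generated by $x_0,x_1$, where $x_0(t)=t/2$ on $[0,\frac12]$, $t-\frac14$ on $[\frac12,\frac34]$, $2t-1$ on $[\frac34,1]$; and $x_1(t)=t$ on $[0,\frac12]$, $\frac t2+\frac14$ on $[\frac12,\frac34]$, $t-\frac18$ on $[\frac34,\frac78]$, $2t-1$ on $[\frac78,1]$. Schreier graph $\Gamma$ of the orbit of $\frac12$: the vertices are the points of the orbit (all dyadic rationals in $(0,1)$), with a directed edge labeled $s\in\{x_0,x_1\}$ from $y$ to $z$ iff $y^s=z$. $\mathcal T$ is the space of isomorphism classes of connected pointed marked graphs: directed graphs with edges labeled by $x_0,x_1$ such that every vertex has exactly one outgoing and exactly one incoming edge of each label, with a selected base vertex; isomorphisms preserve orientation, labels and base vertex. The metric is $d((\Gamma_1,u),(\Gamma_2,v))=2^{-n}$,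 where $n$ is the largest integer such that the balls of radius $n$ around $u$ and $v$ are isomorphic as pointed marked graphs (and $d=0$ if the pointed graphs are isomorphic). The Cantor–Bendixson rank of a space is the (ordinal) number of times one has to remove all isolated points to reach a perfect set (one without isolated points); the perfect set so obtained is the perfect kernel. Let $X=\{0,1\}$, let $X^*$ be the set of finite words ($\varnothing$ the empty word) and $X^\omega$ the set of infinite words. Type B: the graphs $P(w)$, for arbitrary $w\in X^\omega$, with base vertex $a_{n-1}(g_0)$ for some $n\geq1$ (where $a_0(g_0):=g_0$) or $b_n(g_0)$ for some $n\ge1$. Here, for $w=w_1w_2w_3\ldots$, the grey vertices of $P(w)$ are: $g_k$ for $k\ge0$; $d_0(p)$ for $p\in X^*$, with the identification $d_0(\varnothing)=g_0$; and $d_k(p)$ for $k\ge1$ and $p\in X^*$. Each grey vertex has a left child and a right child: the left child of $d_k(p)$ is $d_k(1p)$ and its right child is $d_k(0p)$ for all $k\ge 0$, $p\in X^*$; for $k\ge1$, if $w_k=0$ then the right child of $g_k$ is $g_{k-1}$ and its left child is $d_k(\varnothing)$, while if $w_k=1$ then the left child of $g_k$ is $g_{k-1}$ and its right child is $d_k(\varnothing)$. In addition, each grey vertex $v$ has attached white vertices $a_i(v)$, $i\ge1$, and black vertices $b_i(v)$, $i\ge1$ (all these vertices are distinct). The edges, for every grey $v$ and every $i\ge1$, are: labeled $x_0$: $v\to b_1(v)$, $b_i(v)\to b_{i+1}(v)$, $a_1(v)\to v$, $a_{i+1}(v)\to a_i(v)$; labeled $x_1$: a loop at $b_i(v)$,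 $a_{i+1}(v)\to a_i(v)$, $a_1(v)\to$ (left child of $v$), $v\to$ (right child of $v$). Type C: the two graphs with vertex set $\mathbb Z$ (any vertex as base vertex): the one with edges $i\to i+1$ labeled $x_0$ and a loop labeled $x_1$ at every $i\in\mathbb Z$; and the one with both an edge $i\to i+1$ labeled $x_0$ and an edge $i\to i+1$ labeled $x_1$ for every $i\in\mathbb Z$. *)

(* Defs.v *)
From HB Require Import structures.
From mathcomp Require Import all_boot all_order all_algebra.
From mathcomp Require Import all_classical all_reals all_analysis.

Set Implicit Arguments.
Unset Strict Implicit.
Unset Printing Implicit Defensive.

Import Order.TTheory GRing.Theory Num.Theory.
Import numFieldNormedType.Exports.

Local Open Scope classical_set_scope.
Local Open Scope ring_scope.

(** * Pointed labelled graphs *)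

Inductive label := lx0 | lx1.

Record pgraph := PGraph {
  vertex : Type;
  edge : label -> vertex -> vertex -> Prop;
  base : vertex }.

Definition isomorphic (G H : pgraph) : Prop :=
  exists f : vertex G -> vertex H,
    [/\ bijective f, f (base G) = base H &
        forall s u v, edge s u v <-> edge s (f u) (f v)].

Definition marked (G : pgraph) : Prop :=
  forall s (u : vertex G),
    (exists! v, edge s u v) /\ (exists! v, edge s v u).

(* [in_ball n v]: some path of length at most n, in which edges may be
   traversed in either direction, joins the base vertex to v. *)
Fixpoint in_ball (G : pgraph) (n : nat) (v : vertex G) : Prop :=
  match n with
  | 0 => v = base G
  | m.+1 => in_ball m v \/
            exists u s, in_ball m u /\ (edge s u v \/ edge s v u)
  end.

Definition graph_connected (G : pgraph) : Prop :=
  forall v : vertex G, exists n, in_ball n v.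

Lemma base_in_ball (G : pgraph) n : in_ball n (base G).
Proof. by elim: n => //= n ih; left. Qed.

(* The subgraph of G induced on the vertices at distance at most n. *)
Definition ball_graph (G : pgraph) (n : nat) : pgraph :=
  @PGraph {v : vertex G | in_ball n v}
    (fun s u v => edge s (sval u) (sval v))
    (exist _ (base G) (base_in_ball G n)).

(** * The space of pointed marked graphs *)

Record graph_class := GraphClass {
  members : set pgraph;
  membersP : exists G, [/\ marked G, graph_connected G &
    members = [set H | isomorphic G H]] }.

(* The phantom argument R is the field in which the metric takes its values. *)
Definition marked_space (R : realType) : Type := graph_class.

Definition balls_agree (t u : graph_class) (n : nat) : Prop :=
  exists G H, [/\ members t G, members u H &
    isomorphic (ball_graph G n) (ball_graph H n)].

Definition largest_radius (t u : graph_class) (n : nat) : Prop :=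
  balls_agree t u n /\ forall m, balls_agree t u m -> (m <= n)%N.

(* The balls of radius 0 may already differ, by a loop at the base vertex;
   the default value 0 of [xget] then gives distance 1. *)
Definition graph_dist (R : realType) (t u : graph_class) : R :=
  if `[< t = u >] then 0 else 2 ^- xget 0%N [set n | largest_radius t u n].

Lemma isomorphic_refl G : isomorphic G G.
Proof. by exists id; split => //; exists id. Qed.

Lemma isomorphic_sym G H : isomorphic G H -> isomorphic H G.
Proof.
move=> [f [[g fK gK] fb fe]]; exists g; split; first by exists f.
  by rewrite -fb fK.
by move=> s u v; rewrite fe !gK.
Qed.

Lemma isomorphic_trans G H K :
  isomorphic G H -> isomorphic H K -> isomorphic G K.
Proof.
move=> [f [bf fb fe]] [g [bg gb ge]]; exists (g \o f); split.
- exact: bij_comp.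
- by rewrite /= fb.
- by move=> s u v; rewrite fe ge.
Qed.

Lemma sval_inj (A : Type) (Q : A -> Prop) (x y : {a | Q a}) :
  sval x = sval y -> x = y.
Proof. by case: x y => [x Qx] [y Qy] /= ?; exact: eq_exist. Qed.

Lemma in_ballS (G : pgraph) m n (v : vertex G) :
  (m <= n)%N -> in_ball m v -> in_ball n v.
Proof. by move/subnK => <-; elim: (n - m)%N => //= k ih /ih; left. Qed.

Section ball_iso.
Variables (G H : pgraph) (n : nat).
Variable f : vertex (ball_graph G n) -> vertex (ball_graph H n).
Hypothesis fb : f (base (ball_graph G n)) = base (ball_graph H n).
Hypothesis fe : forall s u v, edge s u v <-> edge s (f u) (f v).

Lemma ball_iso_in_ball m (v : vertex (ball_graph G n)) :
  (m <= n)%N -> in_ball m (sval v) -> in_ball m (sval (f v)).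
Proof.
elim: m v => [|m ih] v mn /=.
  case: v => v vn /= vb; subst v.
  have -> : exist _ _ vn = base (ball_graph G n) by exact: sval_inj.
  by rewrite fb.
case=> [vm|[u [s [um uv]]]]; first by left; apply: ih => //; exact: ltnW.
right; pose u' : vertex (ball_graph G n) :=
  exist _ u (in_ballS (ltnW mn) um).
exists (sval (f u')), s; split; first by apply: ih => //; exact: ltnW.
by case: uv => uv; [left|right]; apply/fe.
Qed.

End ball_iso.

Lemma isomorphic_ball_le G H m n : (m <= n)%N ->
  isomorphic (ball_graph G n) (ball_graph H n) ->
  isomorphic (ball_graph G m) (ball_graph H m).
Proof.
move=> mn [f [[g fK gK] fb fe]].
have gb : g (base (ball_graph H n)) = base (ball_graph G n).
  by rewrite -fb fK.
have ge s u v : edge s u v <-> edge s (g u) (g v) by rewrite fe !gK.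
pose iG (v : vertex (ball_graph G m)) : vertex (ball_graph G n) :=
  exist _ (sval v) (in_ballS mn (proj2_sig v)).
pose iH (v : vertex (ball_graph H m)) : vertex (ball_graph H n) :=
  exist _ (sval v) (in_ballS mn (proj2_sig v)).
pose f' v : vertex (ball_graph H m) := exist _ (sval (f (iG v)))
  (@ball_iso_in_ball _ _ _ _ fb fe m (iG v) mn (proj2_sig v)).
pose g' v : vertex (ball_graph G m) := exist _ (sval (g (iH v)))
  (@ball_iso_in_ball _ _ _ _ gb ge m (iH v) mn (proj2_sig v)).
have iHf v : iH (f' v) = f (iG v) by exact: sval_inj.
have iGg v : iG (g' v) = g (iH v) by exact: sval_inj.
exists f'; split.
- exists g' => v; apply: sval_inj.
  + by rewrite [LHS]/= iHf fK.
  + by rewrite [LHS]/= iGg gK.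
- apply: sval_inj => /=; rewrite (_ : iG _ = base (ball_graph G n)) ?fb//.
  exact: sval_inj.
- by move=> s u v; exact: (fe s (iG u) (iG v)).
Qed.

Lemma isomorphic_ball G H n :
  isomorphic G H -> isomorphic (ball_graph G n) (ball_graph H n).
Proof.
move=> [f [[g fK gK] fb fe]].
have gb : g (base H) = base G by rewrite -fb fK.
have ge s u v : edge s u v <-> edge s (g u) (g v) by rewrite fe !gK.
have fB m v : in_ball m v -> in_ball m (f v).
  elim: m v => [v -> //|m ih v /= [/ih|[u [s [/ih um uv]]]]]; first by left.
  by right; exists (f u), s; split => //; rewrite -!fe.
have gB m v : in_ball m v -> in_ball m (g v).
  elim: m v => [v -> //|m ih v /= [/ih|[u [s [/ih um uv]]]]]; first by left.
  by right; exists (g u), s; split => //; rewrite -!ge.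
exists (fun v => exist _ (f (sval v)) (fB _ _ (proj2_sig v))); split.
- exists (fun v => exist _ (g (sval v)) (gB _ _ (proj2_sig v))).
  + by move=> [v vn]; apply: sval_inj => /=; rewrite fK.
  + by move=> [v vn]; apply: sval_inj => /=; rewrite gK.
- exact: sval_inj.
- by move=> s [u un] [v vn] /=; exact: fe.
Qed.

Lemma isomorphic_of_balls G H : marked G -> marked H ->
  graph_connected G -> graph_connected H ->
  (forall n, isomorphic (ball_graph G n) (ball_graph H n)) -> isomorphic G H.
Proof.
move=> mG mH cG cH GH.
pose f n := sval (cid (GH n)).
have fP n : [/\ bijective (f n), f n (base _) = base _ &
    forall s u v, edge s u v <-> edge s (f n u) (f n v)].
  exact: svalP (cid (GH n)).
pose nf v := sval (cid (cG v)).
have nfP v : in_ball (nf v) v by exact: (proj2_sig (cid (cG v))).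
pose F n v (vn : in_ball n v) := sval (f n (exist _ v vn)).
have FE k n m v (vn : in_ball n v) (vm : in_ball m v) :
    (k <= n)%N -> (k <= m)%N -> in_ball k v -> F n v vn = F m v vm.
  elim: k v vn vm => [|k ih] v vn vm kn km /=.
    have [_ bn _] := fP n; have [_ bm _] := fP m.
    move=> vb; subst v; rewrite /F.
    have -> : exist _ _ vn = base (ball_graph G n) by exact: sval_inj.
    have -> : exist _ _ vm = base (ball_graph G m) by exact: sval_inj.
    by rewrite bn bm.
  case=> [vk|[u [s [uk uv]]]]; first by apply: ih => //; exact: ltnW.
  have un := in_ballS (ltnW kn) uk; have um := in_ballS (ltnW km) uk.
  have uE := ih u un um (ltnW kn) (ltnW km) uk.
  have [_ _ en] := fP n; have [_ _ em] := fP m.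
  case: uv => uv.
    have := (en s (exist _ u un) (exist _ v vn)).1 uv.
    have := (em s (exist _ u um) (exist _ v vm)).1 uv.
    rewrite /= -/(F m u um) -/(F n u un) -/(F m v vm) -/(F n v vn) uE => e1 e2.
    have [[z [_ zu]] _] := mH s (F m u um).
    by rewrite -(zu _ e1) -(zu _ e2).
  have := (en s (exist _ v vn) (exist _ u un)).1 uv.
  have := (em s (exist _ v vm) (exist _ u um)).1 uv.
  rewrite /= -/(F m u um) -/(F n u un) -/(F m v vm) -/(F n v vn) uE => e1 e2.
  have [_ [z [_ zu]]] := mH s (F m u um).
  by rewrite -(zu _ e1) -(zu _ e2).
have FE' n m v (vn : in_ball n v) (vm : in_ball m v) : F n v vn = F m v vm.
  wlog nm : n m vn vm / (n <= m)%N.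
    by move=> h; case/orP: (leq_total n m) => nm; [|symmetry]; apply: h.
  by apply: (FE n).
pose h v := F _ _ (nfP v).
have hE n v (vn : in_ball n v) : h v = sval (f n (exist _ v vn)).
  exact: (FE' _ n v (nfP v) vn).
have hinj u v : h u = h v -> u = v.
  pose n := maxn (nf u) (nf v).
  have un : in_ball n u := in_ballS (leq_maxl _ _) (nfP u).
  have vn : in_ball n v := in_ballS (leq_maxr _ _) (nfP v).
  rewrite (hE n u un) (hE n v vn) => e.
  have [bf _ _] := fP n.
  have := bij_inj bf (sval_inj e).
  by move/(congr1 sval).
have hsurj w : exists v, h v = w.
  have [n wn] := cH w; have [[g fK gK] _ _] := fP n.
  exists (sval (g (exist _ w wn))).
  rewrite (hE n _ (proj2_sig (g (exist _ w wn)))).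
  set x := exist _ _ _; have -> : x = g (exist _ w wn).
    by rewrite /x; exact: sval_inj.
  by rewrite gK.
have [g gP] := choice hsurj.
exists h; split.
- by exists g => // v; apply: hinj; rewrite gP.
- rewrite (hE 0%N (base G) (base_in_ball G 0)).
  have [_ + _] := fP 0%N; set x := exist _ _ _.
  have -> : x = base (ball_graph G 0) by exact: sval_inj.
  by move=> ->.
- move=> s u v; pose n := maxn (nf u) (nf v).
  have un : in_ball n u := in_ballS (leq_maxl _ _) (nfP u).
  have vn : in_ball n v := in_ballS (leq_maxr _ _) (nfP v).
  rewrite (hE n u un) (hE n v vn).
  by have [_ _ e] := fP n; exact: (e s (exist _ u un) (exist _ v vn)).
Qed.

Lemma members_iso (t : graph_class) G H :
  members t G -> members t H -> isomorphic G H.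
Proof.
case: (membersP t) => K [_ _ ->] /= KG KH.
exact: isomorphic_trans (isomorphic_sym KG) KH.
Qed.

Lemma graph_class_eq (t u : graph_class) G H :
  members t G -> members u H -> isomorphic G H -> t = u.
Proof.
case: t => t tP; case: u => u uP /= tG uH GH.
have [K [_ _ tE]] := tP; have [L [_ _ uE]] := uP.
suff tu : t = u.
  by move: tP {tG tE}; rewrite tu => tP; rewrite (Prop_irrelevance tP uP).
move: tG uH; rewrite tE uE /= => KG LH.
have KL := isomorphic_trans (isomorphic_trans KG GH) (isomorphic_sym LH).
apply/seteqP; split => M /= KM; last exact: isomorphic_trans KL KM.
exact: isomorphic_trans (isomorphic_sym KL) KM.
Qed.

Lemma balls_agreeP t u n : balls_agree t u n ->
  forall G H, members t G -> members u H ->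
  isomorphic (ball_graph G n) (ball_graph H n).
Proof.
move=> [G [H [tG uH GH]]] G' H' tG' uH'.
apply: isomorphic_trans (isomorphic_ball n (members_iso tG' tG)) _.
exact: isomorphic_trans GH (isomorphic_ball n (members_iso uH uH')).
Qed.

Lemma members_ex (t : graph_class) :
  exists G, [/\ marked G, graph_connected G & members t G].
Proof.
case: (membersP t) => K [mK cK E]; exists K; split=> //.
by rewrite E; exact: isomorphic_refl.
Qed.

Lemma balls_agree_refl t n : balls_agree t t n.
Proof.
have [G [_ _ tG]] := members_ex t; exists G, G; split => //.
exact: isomorphic_refl.
Qed.

Lemma balls_agree_sym t u n : balls_agree t u n -> balls_agree u t n.
Proof.
by move=> [G [H [? ? /isomorphic_sym ?]]]; exists H, G; split.
Qed.

Lemma balls_agree_trans t u v n :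
  balls_agree t u n -> balls_agree u v n -> balls_agree t v n.
Proof.
move=> [G [H [tG uH GH]]] /balls_agreeP uv.
have [K [_ _ vK]] := members_ex v; exists G, K; split => //.
exact: isomorphic_trans GH (uv _ _ uH vK).
Qed.

Lemma balls_agree_le t u m n : (m <= n)%N ->
  balls_agree t u n -> balls_agree t u m.
Proof.
move=> mn [G [H [tG uH GH]]]; exists G, H; split => //.
exact: isomorphic_ball_le mn GH.
Qed.

Lemma balls_agree_eq t u : (forall n, balls_agree t u n) -> t = u.
Proof.
have [G [mG cG tG]] := members_ex t; have [H [mH cH uH]] := members_ex u.
move=> tu; apply: (graph_class_eq tG uH).
by apply: isomorphic_of_balls => // n; exact: balls_agreeP (tu n) _ _ tG uH.
Qed.

Lemma graph_dist_le (R : realType) t u n :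
  graph_dist R t u <= 2 ^- n <-> n = 0%N \/ balls_agree t u n.
Proof.
have pow_le a b : (2 ^- a <= 2 ^- b :> R) = (b <= a)%N.
  by rewrite lef_pV2 ?posrE ?exprn_gt0// ler_eXn2l// ltr1n.
rewrite /graph_dist; case: asboolP => [->|tu].
  split=> _; first by right; exact: balls_agree_refl.
  by rewrite invr_ge0 exprn_ge0.
rewrite pow_le; case: xgetP => [k _ [tuk kmax]|none].
  split=> [nk|[-> //|/kmax //]]; right; exact: balls_agree_le nk tuk.
split; first by rewrite leqn0 => /eqP ->; left.
case=> [-> //|tun]; exfalso.
have [N tuN] : exists N, ~ balls_agree t u N.
  by apply/existsNP => h; apply: tu; exact: balls_agree_eq.
have P : exists k, `[< balls_agree t u k >] by exists n; apply/asboolP.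
have bd k : `[< balls_agree t u k >] -> (k <= N)%N.
  move=> /asboolP tuk; rewrite leqNgt; apply/negP => /ltnW Nk.
  exact/tuN/(balls_agree_le Nk).
case: (ex_maxnP P bd) => k /asboolP tuk kmax.
by apply: (none k); split => // m ?; apply: kmax; exact/asboolP.
Qed.

Section metric.
Variable R : realType.
Implicit Types t u v : marked_space R.

Let dist t u : R := graph_dist R t u.

Let dist_pow t u : dist t u = 0 \/ exists n, dist t u = 2 ^- n.
Proof.
by rewrite /dist /graph_dist; case: asboolP => _; [left|right; eexists].
Qed.

Let dist_xx t : dist t t = 0.
Proof. by rewrite /dist /graph_dist asboolT. Qed.

Let dist_eq0 t u : dist t u = 0 -> t = u.
Proof.
rewrite /dist /graph_dist; case: asboolP => // _ /eqP.
by rewrite invr_eq0 expf_eq0 pnatr_eq0 andbF.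
Qed.

Let dist_sym t u : dist t u = dist u t.
Proof.
rewrite /dist /graph_dist.
have -> : `[< t = u >] = `[< u = t >] by congr asbool; exact/propext.
congr (if _ then _ else 2 ^- xget _ _); apply/seteqP.
by split=> n [/balls_agree_sym a b]; split => // m /balls_agree_sym /b.
Qed.

Let dist_triangle u t v : dist t v <= dist t u + dist u v.
Proof.
case: (dist_pow t u) => [/[dup] /dist_eq0 <- ->|[a aE]].
  by rewrite add0r.
case: (dist_pow u v) => [/[dup] /dist_eq0 <- ->|[b bE]].
  by rewrite addr0.
have ta : a = 0%N \/ balls_agree t u a by apply/(graph_dist_le R); rewrite -aE.
have ub : b = 0%N \/ balls_agree u v b by apply/(graph_dist_le R); rewrite -bE.
have tv : dist t v <= 2 ^- minn a b.
  apply/graph_dist_le; case: ta => [->|ta]; first by rewrite min0n; left.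
  case: ub => [->|ub]; first by rewrite minn0; left.
  right; apply: (@balls_agree_trans _ u).
    exact: balls_agree_le (geq_minl _ _) ta.
  exact: balls_agree_le (geq_minr _ _) ub.
apply: le_trans tv _; rewrite aE bE.
by case: leqP => _; rewrite ?lerDl ?lerDr invr_ge0 exprn_ge0.
Qed.

HB.instance Definition _ := gen_eqMixin (marked_space R).
HB.instance Definition _ := gen_choiceMixin (marked_space R).
HB.instance Definition _ := isMetric.Build R (marked_space R)
  dist_xx dist_eq0 dist_sym dist_triangle.

End metric.

(** * Thompson's group F and the Schreier graph *)

Section thompson.
Variable R : realType.

Definition dyadic (x : R) : Prop :=
  exists (m : int) (n : nat), x = m%:~R / 2 ^+ n.

Definition piecewise_linear (f : R -> R) : Prop :=
  exists s : seq R, forall a b, 0 <= a -> a < b -> b <= 1 ->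
    (forall c, c \in s -> ~ (a < c < b)) ->
    exists m k : R, forall x, a <= x <= b -> f x = m * x + k.

(* Homeomorphisms of [0,1] are represented by functions on R whose values
   outside [0,1] are irrelevant. *)
Definition thompsonF (f : R -> R) : Prop :=
  [/\ set_bij `[0, 1] `[0, 1] f /\ {within `[0, 1], continuous f},
      {in `[0, 1] &, {homo f : x y / x < y}},
      piecewise_linear f &
      exists s : seq R, (forall c, c \in s -> dyadic c) /\
        forall x, 0 < x < 1 -> x \notin s ->
          derivable f x 1 /\ exists k : int, f^`()%classic x = 2 ^ k].

Definition x0 (t : R) : R :=
  if t <= 1 / 2 then t / 2 else if t <= 3 / 4 then t - 1 / 4 else 2 * t - 1.

Definition x1 (t : R) : R :=
  if t <= 1 / 2 then t else if t <= 3 / 4 then t / 2 + 1 / 4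
  else if t <= 7 / 8 then t - 1 / 8 else 2 * t - 1.

Definition act (s : label) : R -> R := match s with lx0 => x0 | lx1 => x1 end.

Definition orbit_half : set R := [set y | exists2 f, thompsonF f & f (1 / 2) = y].

Definition schreier (q : {y : R | orbit_half y}) : pgraph :=
  @PGraph {y : R | orbit_half y} (fun s y z => act s (sval y) = sval z) q.

Definition schreier_set : set (marked_space R) :=
  [set t | exists q, members t (schreier q)].

End thompson.
Arguments orbit_half : clear implicits.
Arguments schreier_set : clear implicits.

(** * Graphs of types B and C *)

(* The vertices g_k and d_k(p) with the identification d_0(empty) = g_0:
   [grey_gS k] is g_(k+1) and [grey_d k p] is d_k(p).  The letters 0 and 1 are
   [false] and [true]. *)
Inductive grey := grey_gS of nat | grey_d of nat & seq bool.

Definition grey_g (k : nat) : grey :=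
  if k is k'.+1 then grey_gS k' else grey_d 0 [::].

(* The letter w_k of an infinite word, k >= 1, is [w k.-1]; in particular
   w_(k+1), which governs the children of [grey_gS k], is [w k]. *)
Definition left_child (w : nat -> bool) (v : grey) : grey :=
  match v with
  | grey_gS k => if w k then grey_g k else grey_d k.+1 [::]
  | grey_d k p => grey_d k (true :: p)
  end.

Definition right_child (w : nat -> bool) (v : grey) : grey :=
  match v with
  | grey_gS k => if w k then grey_d k.+1 [::] else grey_g k
  | grey_d k p => grey_d k (false :: p)
  end.

(* [white i v] is a_(i+1)(v) and [black i v] is b_(i+1)(v). *)
Inductive Pvertex :=
  | Grey of grey
  | white of nat & grey
  | black of nat & grey.

Inductive Pedge (w : nat -> bool) : label -> Pvertex -> Pvertex -> Prop :=
  | P0_grey v : Pedge w lx0 (Grey v) (black 0 v)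
  | P0_black i v : Pedge w lx0 (black i v) (black i.+1 v)
  | P0_white1 v : Pedge w lx0 (white 0 v) (Grey v)
  | P0_white i v : Pedge w lx0 (white i.+1 v) (white i v)
  | P1_black i v : Pedge w lx1 (black i v) (black i v)
  | P1_white i v : Pedge w lx1 (white i.+1 v) (white i v)
  | P1_white1 v : Pedge w lx1 (white 0 v) (Grey (left_child w v))
  | P1_grey v : Pedge w lx1 (Grey v) (Grey (right_child w v)).

Definition P_graph (w : nat -> bool) (q : Pvertex) : pgraph := PGraph (Pedge w) q.

(* a_n(v) for n >= 0, with the convention a_0(v) = v. *)
Definition a_ (n : nat) (v : grey) : Pvertex :=
  if n is m.+1 then white m v else Grey v.

(* b_n(v) for n >= 1; b_0(v) is a junk value. *)
Definition b_ (n : nat) (v : grey) : Pvertex :=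
  if n is m.+1 then black m v else Grey v.

Definition type_B (G : pgraph) : Prop :=
  exists w : nat -> bool, exists2 n : nat, (1 <= n)%N &
    G = P_graph w (a_ n.-1 (grey_g 0)) \/ G = P_graph w (b_ n (grey_g 0)).

Definition line_loops (i : int) : pgraph :=
  @PGraph int (fun s j k => match s with lx0 => k = j + 1 | lx1 => k = j end) i.

Definition line_double (i : int) : pgraph :=
  @PGraph int (fun _ j k => k = j + 1) i.

Definition type_C (G : pgraph) : Prop :=
  exists i : int, G = line_loops i \/ G = line_double i.

Definition types_BC (R : realType) : set (marked_space R) :=
  [set t | exists2 G, type_B G \/ type_C G & members t G].
Arguments types_BC : clear implicits.

(** * Cantor-Bendixson rank *)

Section cantor_bendixson.
Variable T : topologicalType.
Implicit Types A K : set T.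

Definition CB_derivative A : set T := A `\` isolated A.

Definition no_isolated_point A : Prop := isolated A = set0.

(* Restricted to finite ordinals n, so that limit stages do not occur. *)
Definition has_CB_rank A (n : nat) : Prop :=
  no_isolated_point (iter n CB_derivative A) /\
  forall m, (m < n)%N -> ~ no_isolated_point (iter m CB_derivative A).

Definition is_perfect_kernel A K : Prop :=
  exists2 n, has_CB_rank A n & K = iter n CB_derivative A.

End cantor_bendixson.

Definition homeomorphic (X Y : topologicalType) : Prop :=
  exists (f : X -> Y) (g : Y -> X),
    [/\ cancel f g, cancel g f, continuous f & continuous g].

(* Main.v *)
From HB Require Import structures.
From mathcomp Require Import all_boot all_order all_algebra.
From mathcomp Require Import all_classical all_reals all_analysis.
From mathcomp Require Import ring lra zify.
Require Import Defs.

Set Implicit Arguments.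
Unset Strict Implicit.
Unset Printing Implicit Defensive.

Import Order.TTheory GRing.Theory Num.Theory.
Import numFieldNormedType.Exports.

Local Open Scope classical_set_scope.
Local Open Scope ring_scope.

(** The balls of a marked graph around its base vertex are determined by the
    words in [x0], [x1] and their inverses that are read along loops at the base
    vertex.  So the metric topology on pointed marked graphs is the topology of
    pointwise convergence of the sets of loops ([nbhs_same_loops]), and
    everything is about which short words are loops.

    The Schreier graph and the graphs P(w) have the same shape: over every
    vertex v of a binary tree there is a grey vertex with a branch of white
    vertices and a branch of black ones ([tree_graph]).  For P(w), the tree is an
    infinite binary tree seen from the vertex g_0, with the ancestors g_k placed
    according to w.  For the Schreier graph, the orbit of 1/2 consists of the
    dyadic numbers of (0,1) ([orbit_halfE]); writing them as 1...10u, 10u or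
    0...01u gives a tree whose vertices are the finitely supported binary
    sequences u, and the children of u are 0u and 1u ([act_point]).  The zero
    sequence, which stands for 1/2, is its own child.

    A word of length l that starts over the sequence u reads at most l letters of
    u.  Therefore it does not tell the Schreier graph at u from its unfolding
    P(u), unless u vanishes from the letter l on and the base vertex is at
    distance at most l from the grey vertex ([loop_unfold]); far out on a branch
    it sees nothing but a line ([loop_far]).  Hence the graphs of types B and C
    are limits of Schreier graphs.  On the other hand 1/2 is characterized by
    three short words ([rootP]), so that a Schreier graph with base vertex near
    1/2 is determined by a ball of known radius ([tail_graph_rigid]).  It follows
    that the Schreier graphs are isolated in the closure, and that the closure
    contains nothing but Schreier graphs and graphs of types B and C.

    The graphs of types B and C are coded by the infinite words
    s 1...1 0 w: the sign s and the number of letters 1 give the position of the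
    base vertex, and s 1 1 1 ... codes the two lines, which are the limits of
    P(w) as the base vertex goes to infinity along either branch.  The coding is
    a continuous bijection from the Cantor set, hence a homeomorphism, and the
    set of these graphs is closed and has no isolated point. *)

(** * Words, walks and loops *)

(** The letter [(s, true)] is the generator [s] and [(s, false)] its
    inverse. *)
Definition letter : Type := label * bool.
Definition word : Type := seq letter.

Definition inv_letter (l : letter) : letter := (l.1, ~~ l.2).
Definition inv_word (p : word) : word := rev (map inv_letter p).

Definition crosses (G : pgraph) (l : letter) (u v : vertex G) : Prop :=
  if l.2 then edge l.1 u v else edge l.1 v u.

Fixpoint walk (G : pgraph) (p : word) (u v : vertex G) : Prop :=
  if p is l :: p' then exists2 z, crosses l u z & walk p' z v else u = v.

Definition loop (G : pgraph) (p : word) : Prop := walk p (base G) (base G).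

Section walks.
Variable G : pgraph.
Implicit Types (u v : vertex G) (p q : word).

Lemma crosses_inv l u v : crosses (inv_letter l) u v <-> crosses l v u.
Proof. by case: l => s []. Qed.

Lemma walk_cat p q u v :
  walk (p ++ q) u v <-> exists2 z, walk p u z & walk q z v.
Proof.
elim: p u => [|l p ih] u /=.
  by split=> [h|[z ->]//]; exists u.
split=> [[z uz /ih[y zy yv]]|[y [z uz zy] yv]].
  by exists y => //; exists z.
by exists z => //; apply/ih; exists y.
Qed.

Lemma walk1 l u v : walk [:: l] u v <-> crosses l u v.
Proof. by split=> [[z uz <-]//|uv]; exists v. Qed.

Lemma walk_inv p u v : walk (inv_word p) u v <-> walk p v u.
Proof.
elim: p u v => [|l p ih] u v; first by split=> /= ->.
rewrite /inv_word /= rev_cons -cats1; split.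
  by move=> /walk_cat[z /ih zu /walk1 /crosses_inv vz]; exists z.
move=> [z vz zu]; apply/walk_cat; exists z; first exact/ih.
by apply/walk1/crosses_inv.
Qed.

Lemma in_ballP n v : in_ball n v <-> exists2 p, (size p <= n)%N & walk p (base G) v.
Proof.
elim: n v => [|n ih] v.
  split=> [->|[[|l p]//= _ <-]//]; by exists [::].
split.
  case=> [/ih[p pn pv]|[u [s [/ih[p pn pu] uv]]]].
    by exists p => //; exact: leqW.
  case: uv => uv.
    exists (rcons p (s, true)); first by rewrite size_rcons.
    by rewrite -cats1; apply/walk_cat; exists u => //; apply/walk1.
  exists (rcons p (s, false)); first by rewrite size_rcons.
  by rewrite -cats1; apply/walk_cat; exists u => //; apply/walk1.
case; elim/last_ind => [_ <-|p [s e] _]; first by left; exact: base_in_ball.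
rewrite size_rcons ltnS => pn; rewrite -cats1 => /walk_cat[z pz /walk1 zv].
right; exists z, s; split; first by apply/ih; exists p.
by case: e zv; [left|right].
Qed.

Hypothesis mG : marked G.

Lemma crosses_ex l u : exists v, crosses l u v.
Proof.
case: l => s []; rewrite /crosses /=.
  by have [[v [? _]] _] := mG s u; exists v.
by have [_ [v [? _]]] := mG s u; exists v.
Qed.

Lemma crosses_fun l u v v' : crosses l u v -> crosses l u v' -> v = v'.
Proof.
case: l => s []; rewrite /crosses /=.
  by have [[z [_ zu]] _] := mG s u => /zu <- /zu.
by have [_ [z [_ zu]]] := mG s u => /zu <- /zu.
Qed.

Lemma walk_ex p u : exists v, walk p u v.
Proof.
elim: p u => [|l p ih] u; first by exists u.
by have [z uz] := crosses_ex l u; have [v zv] := ih z; exists v, z.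
Qed.

Lemma walk_fun p u v v' : walk p u v -> walk p u v' -> v = v'.
Proof.
elim: p u => [|l p ih] u /= => [<-//|[z uz zv] [z' uz' zv']].
by rewrite -(crosses_fun uz uz') in zv'; exact: ih zv zv'.
Qed.

(** This is why the loops at the base vertex determine a connected marked graph:
    its vertices are the ends of the walks from the base vertex, and loops tell
    which of these ends coincide. *)
Lemma walk_meet p q u v v' :
  walk p u v -> walk q u v' -> (v = v' <-> walk (p ++ inv_word q) u u).
Proof.
move=> uv uv'; split=> [e|/walk_cat[z uz /walk_inv uz']].
  by apply/walk_cat; exists v => //; apply/walk_inv; rewrite e.
by rewrite (walk_fun uv uz) (walk_fun uv' uz').
Qed.

Lemma walk_meet_edge p q s u v v' : walk p u v -> walk q u v' ->
  (edge s v v' <-> walk (p ++ (s, true) :: inv_word q) u u).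
Proof.
move=> uv uv'; rewrite -cat_rcons -cats1.
have [z vz] := crosses_ex (s, true) v.
have uz : walk (p ++ [:: (s, true)]) u z.
  by apply/walk_cat; exists v => //; exact/walk1.
rewrite -(walk_meet uz uv'); split=> [e|<-//].
exact: crosses_fun vz e.
Qed.

End walks.

Lemma size_inv_word p : size (inv_word p) = size p.
Proof. by rewrite size_rev size_map. Qed.

(** Two walks of length at most [n] and possibly an edge joining their ends make
    a closed walk of length at most [2n+1]. *)
Lemma isomorphic_ball_of_loops G H n : marked G -> marked H ->
  (forall p, (size p <= n + n.+1)%N -> loop G p <-> loop H p) ->
  isomorphic (ball_graph G n) (ball_graph H n).
Proof.
move=> mG mH GH.
have exw (v : vertex (ball_graph G n)) : exists p, (size p <= n)%N /\
    walk p (base G) (sval v).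
  by have /in_ballP[p pn pv] := proj2_sig v; exists p.
have [wd wdP] := choice exw.
have exf (v : vertex (ball_graph G n)) : exists y : vertex (ball_graph H n),
    walk (wd v) (base H) (sval y).
  have [y wy] := walk_ex mH (wd v) (base H).
  have yn : in_ball n y by apply/in_ballP; exists (wd v) => //; case: (wdP v).
  by exists (exist _ y yn).
have [f fP] := choice exf.
have fE p v y : (size p <= n)%N -> walk p (base G) (sval v) ->
    walk p (base H) (sval y) -> f v = y.
  move=> pn pv py; apply: sval_inj; have [wn wv] := wdP v.
  apply/(walk_meet mH (fP v) py)/(GH _ _).1; last exact/(walk_meet mG wv pv).
  by rewrite size_cat size_inv_word leq_add// leqW.
have finj u v : f u = f v -> u = v.
  move=> e; apply: sval_inj; have [un wu] := wdP u; have [vn wv] := wdP v.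
  apply/(walk_meet mG wu wv)/(GH _ _).2.
    by rewrite size_cat size_inv_word leq_add// leqW.
  by apply/(walk_meet mH (fP u) (fP v)); rewrite e.
have fsurj y : exists v, f v = y.
  have /in_ballP[p pn py] := proj2_sig y.
  have [v pv] := walk_ex mG p (base G).
  have vn : in_ball n v by apply/in_ballP; exists p.
  by exists (exist _ v vn); exact: fE pn _ py.
have [g gP] := choice fsurj.
exists f; split.
- by exists g => // v; apply: finj; rewrite gP.
- exact: (fE [::]).
- move=> s u v /=; have [un wu] := wdP u; have [vn wv] := wdP v.
  rewrite (walk_meet_edge mG s wu wv) (walk_meet_edge mH s (fP u) (fP v)).
  apply: GH; rewrite size_cat /= size_inv_word leq_add//.
Qed.

Lemma isomorphic_ball_walk G H n (f : vertex (ball_graph G n) ->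
    vertex (ball_graph H n)) (k : nat) p (u : vertex (ball_graph G n)) v :
  (forall s u v, edge s u v <-> edge s (f u) (f v)) ->
  in_ball k (sval u) -> (k + size p <= n)%N -> walk p (sval u) v ->
  exists2 v', sval v' = v & walk p (sval (f u)) (sval (f v')).
Proof.
move=> fe; elim: p k u => [|[s e] p ih] k u /= uk kn; first by move=> <-; exists u.
move=> [z uz zv]; have zk : in_ball k.+1 z.
  by right; exists (sval u), s; split => //; case: e uz; [left|right].
have zn : in_ball n z by apply: in_ballS zk; lia.
have [|v' <- zv'] := ih k.+1 (exist _ z zn) zk _ zv; first by lia.
exists v' => //; exists (sval (f (exist _ z zn))) => //.
by case: e uz => uz; apply/(fe s _ _).1.
Qed.

Lemma loop_ball G H n p : (size p <= n)%N ->
  isomorphic (ball_graph G n) (ball_graph H n) -> loop G p <-> loop H p.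
Proof.
move=> pn; suff imp G' H' : isomorphic (ball_graph G' n) (ball_graph H' n) ->
    loop G' p -> loop H' p.
  by move=> GH; split; apply: imp => //; exact: isomorphic_sym.
move=> [f [_ fb fe]] wp.
have [v' vb] := isomorphic_ball_walk (k := 0) (u := base _) fe erefl pn wp.
have -> : v' = base (ball_graph G' n) by exact: sval_inj.
by rewrite fb.
Qed.

Lemma loop_isomorphic G H p : isomorphic G H -> loop G p <-> loop H p.
Proof.
by move=> GH; apply: (@loop_ball _ _ (size p)) => //; exact: isomorphic_ball.
Qed.

(** * The topology of the space of marked graphs in terms of loops *)

Definition loops_of (t : graph_class) (p : word) : Prop :=
  exists2 G, members t G & loop G p.

Lemma loops_ofE t G p : members t G -> loops_of t p <-> loop G p.
Proof.
move=> tG; split=> [[H tH]|]; last by exists G.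
exact/(loop_isomorphic p (members_iso tH tG)).1.
Qed.

Definition same_loops (n : nat) (t u : graph_class) : Prop :=
  forall p, (size p <= n)%N -> loops_of t p <-> loops_of u p.

Lemma same_loops_sym n t u : same_loops n t u -> same_loops n u t.
Proof. by move=> tu p /tu ->. Qed.

Lemma same_loops_trans n t u v :
  same_loops n t u -> same_loops n u v -> same_loops n t v.
Proof. by move=> tu uv p pn; rewrite (tu p pn) (uv p pn). Qed.

Lemma same_loops_le m n t u : (m <= n)%N -> same_loops n t u -> same_loops m t u.
Proof. by move=> mn tu p pm; apply: tu; exact: leq_trans mn. Qed.

Lemma balls_agree_of_same_loops n t u :
  same_loops (n + n.+1) t u -> balls_agree t u n.
Proof.
move=> tu; have [G [mG _ tG]] := members_ex t; have [H [mH _ uH]] := members_ex u.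
exists G, H; split => //; apply: isomorphic_ball_of_loops => // p pn.
by rewrite -(loops_ofE p tG) -(loops_ofE p uH); exact: tu.
Qed.

Lemma same_loops_of_balls_agree n t u : balls_agree t u n -> same_loops n t u.
Proof.
move=> [G [H [tG uH GH]]] p pn.
by rewrite (loops_ofE p tG) (loops_ofE p uH); exact: loop_ball GH.
Qed.

Lemma same_loops_eq t u : (forall n, same_loops n t u) -> t = u.
Proof.
by move=> tu; apply: balls_agree_eq => n; exact: balls_agree_of_same_loops.
Qed.

Section topology.
Variable R : realType.
Implicit Types (t u : marked_space R) (A : set (marked_space R)).

Lemma mdistE t u : mdist t u = graph_dist R t u.
Proof. by []. Qed.

Lemma exp2N_lt (e : R) : 0 < e -> exists n, 2 ^- n < e.
Proof.
move=> e0; have [n _ ne] : \forall n \near \oo, (2^-1) ^+ n < e.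
  have : (fun n => (2^-1 : R) ^+ n) @ \oo --> (0 : R).
    by apply: cvg_expr; rewrite ger0_norm// invf_lt1// ltr1n.
  move=> /cvgr0_norm_lt /(_ e e0); apply: filterS => n.
  exact: le_lt_trans (ler_norm _).
by exists n; rewrite -exprVn; apply: ne => /=.
Qed.

(** A ball of radius n is recovered from the loops of length at most 2n+1, and
    conversely a loop of length at most n stays in the ball of radius n. *)
Lemma nbhs_same_loops t (U : set (marked_space R)) :
  nbhs t U <-> exists n, forall u, same_loops n t u -> U u.
Proof.
split=> [/nbhs_ballP[e /= e0 eU]|[n nU]].
  have [n ne] := exp2N_lt e0; exists (n + n.+1)%N => u tu; apply: eU.
  rewrite ballEmdist /= mdistE; apply: le_lt_trans ne.
  by apply/graph_dist_le; right; exact: balls_agree_of_same_loops.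
apply/nbhs_ballP; exists (2 ^- n.+1); first by rewrite /= invr_gt0 exprn_gt0.
move=> u; rewrite ballEmdist /= mdistE => /ltW /graph_dist_le[//|tu].
by apply: nU; apply: same_loops_le (same_loops_of_balls_agree tu).
Qed.

Lemma closure_same_loops A t :
  closure A t <-> forall n, exists2 u, A u & same_loops n t u.
Proof.
split=> [At n|h U /nbhs_same_loops[n nU]].
  have [|u [Au tu]] := At [set u | same_loops n t u]; last by exists u.
  by apply/nbhs_same_loops; exists n.
by have [u Au tu] := h n; exists u; split => //; exact: nU.
Qed.

End topology.

(** * Graphs built over binary trees *)

(** These trees have no root: every vertex has a parent.  A vertex may be its
    own parent, as the point 1/2 is in the tree of the Schreier graph. *)
Record bintree := BinTree {
  node : Type;
  child : bool -> node -> node;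
  parent : node -> node;
  side : node -> bool;
  parent_child : forall b v, parent (child b v) = v;
  side_child : forall b v, side (child b v) = b;
  child_parent : forall v, child (side v) (parent v) = v }.

(** The grey vertex v is [(0, v)], the white vertex a_i(v) is [(i, v)] and the
    black vertex b_i(v) is [(- i, v)], so that [x0] is a translation. *)
Definition step (T : bintree) (l : letter) (x : int * node T) : int * node T :=
  match l.1, x.1 with
  | lx0, n => (if l.2 then n - 1 else n + 1, x.2)
  | lx1, Negz _ => x
  | lx1, Posz i =>
    if l.2 then
      match i with
      | 0 => (Posz 0, child false x.2)
      | 1 => (Posz 0, child true x.2)
      | j.+2 => (Posz j.+1, x.2)
      end
    else if i is j.+1 then (Posz j.+2, x.2)
    else (Posz (side x.2), parent x.2)
  end.

Definition tree_graph (T : bintree) (x : int * node T) : pgraph :=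
  @PGraph (int * node T) (fun s y z => step (s, true) y = z) x.

Definition run (T : bintree) (p : word) (x : int * node T) : int * node T :=
  foldl (fun y l => step l y) x p.

Section tree_graph.
Variable T : bintree.
Implicit Types (x y : int * node T) (v : node T).

Lemma stepK s b : cancel (@step T (s, b)) (step (s, ~~ b)).
Proof.
case: s b => [] [] [[[|[|j]]|i] v]; rewrite /step /= ?addrK ?subrK//.
- by rewrite side_child parent_child.
- by rewrite side_child parent_child.
- by case E: (side v) => /=; rewrite -{2}(child_parent v) E.
Qed.

Lemma crosses_step x l y z : @crosses (tree_graph x) l y z <-> step l y = z.
Proof.
case: l => s []; rewrite /crosses /=; [by []|]; split=> <-.
  exact: (stepK s true).
exact: (stepK s false).
Qed.

Lemma walk_run x p y z : @walk (tree_graph x) p y z <-> run p y = z.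
Proof.
elim: p y => [//|l p ih] y /=; split=> [[y' /crosses_step <- /ih]//|pz].
by exists (step l y); [exact/crosses_step|exact/ih].
Qed.

Lemma loop_run x p : loop (tree_graph x) p <-> run p x = x.
Proof. exact: walk_run. Qed.

Lemma marked_tree_graph x : marked (tree_graph x).
Proof.
move=> s y; split; first by exists (step (s, true) y); split.
exists (step (s, false) y); split; first exact: (stepK s false).
by move=> z <-; exact: (stepK s true).
Qed.

Lemma run_cat p q x : run (p ++ q) x = run q (run p x).
Proof. exact: foldl_cat. Qed.

Lemma run_inv p x y : run (inv_word p) x = y <-> run p y = x.
Proof. by rewrite -!(@walk_run x); exact: walk_inv. Qed.

Lemma run_x0 k n v : run (nseq k (lx0, true)) (n, v) = (n - k%:Z, v).
Proof.
elim: k n => [|k ih] n; first by rewrite subr0.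
by rewrite /= ih; congr pair => /=; lia.
Qed.

Lemma run_x0V k n v : run (nseq k (lx0, false)) (n, v) = (n + k%:Z, v).
Proof.
elim: k n => [|k ih] n; first by rewrite addr0.
by rewrite /= ih; congr pair => /=; lia.
Qed.

Lemma run_to_grey n v : exists2 p, size p = `|n|%N & run p (n, v) = (0, v).
Proof.
case: n => i.
  by exists (nseq i (lx0, true)); rewrite ?size_nseq// run_x0 subrr.
by exists (nseq i.+1 (lx0, false)); rewrite ?size_nseq// run_x0V; congr pair => /=; lia.
Qed.

Lemma run_to_parent v : exists2 p, size p = (side v).+1 & run p (0, v) = (0, parent v).
Proof.
case E: (side v).
  by exists [:: (lx1, false); (lx0, true)] => //; rewrite /run /= /step /= E.
by exists [:: (lx1, false)] => //; rewrite /run /= /step /= E.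
Qed.

(** Grey vertices are enough because every vertex is joined by a power of [x0]
    to the grey vertex on its branch. *)
Lemma connected_tree_graph x :
  (forall v v', exists p, run p (0, v) = (0, v')) -> graph_connected (tree_graph x).
Proof.
move=> h; case: x => n v [m v'].
have [p _ pv] := run_to_grey n v; have [q _ qv] := run_to_grey m v'.
have [r rv] := h v v'; exists (size (p ++ r ++ inv_word q)).
apply/in_ballP; exists (p ++ r ++ inv_word q) => //; apply/walk_run.
by rewrite !run_cat pv rv; apply/run_inv.
Qed.

End tree_graph.

Definition is_tree_morph (T T' : bintree) (f : node T -> node T') : Prop :=
  forall b v, f (child b v) = child b (f v).

Section tree_morph.
Variables (T T' : bintree) (f : node T -> node T').
Hypothesis fM : is_tree_morph f.

Definition move (x : int * node T) : int * node T' := (x.1, f x.2).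

Lemma tree_morph_parent v : f (parent v) = parent (f v).
Proof. by rewrite -{2}(child_parent v) fM parent_child. Qed.

Lemma tree_morph_side v : side (f v) = side v.
Proof. by rewrite -{1}(child_parent v) fM side_child. Qed.

Lemma move_step l x : move (step l x) = step l (move x).
Proof.
case: l x => [[] []] [[[|[|j]]|i] v] //=; rewrite /move /step /= ?fM//.
by rewrite tree_morph_parent tree_morph_side.
Qed.

Lemma move_run p x : move (run p x) = run p (move x).
Proof. by elim: p x => //= l p ih x; rewrite ih move_step. Qed.

End tree_morph.

(** ** Lines *)

Definition line (d : bool) (i : int) : pgraph :=
  if d then line_double i else line_loops i.

Definition letter_shift (d : bool) (l : letter) : int :=
  if l.1 is lx1 then (if d then (if l.2 then 1 else -1) else 0)
  else if l.2 then 1 else -1.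

Definition word_shift (d : bool) (p : word) : int := \sum_(l <- p) letter_shift d l.

Lemma word_shift_cons d l p : word_shift d (l :: p) = letter_shift d l + word_shift d p.
Proof. by rewrite /word_shift big_cons. Qed.

Lemma word_shift_cat d p q : word_shift d (p ++ q) = word_shift d p + word_shift d q.
Proof. by rewrite /word_shift big_cat. Qed.

Lemma word_shift_inv d p : word_shift d (inv_word p) = - word_shift d p.
Proof.
elim: p => [|l p ih]; first by rewrite /inv_word /word_shift big_nil oppr0.
rewrite /inv_word /= rev_cons -cats1 -/(inv_word p) word_shift_cat ih !word_shift_cons.
rewrite /word_shift big_nil.
by case: l d {ih} => [] [] [] []; rewrite /letter_shift /=; lia.
Qed.

Lemma walk_shift d (e : label -> int -> int -> Prop) i p j k :
  (forall s j k, e s j k <-> k = j + letter_shift d (s, true)) ->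
  @walk (PGraph e i) p j k <-> k = j + word_shift d p.
Proof.
move=> eE; have cE l (u v : vertex (PGraph e i)) :
    crosses l u v <-> v = u + letter_shift d l.
  case: l => s []; rewrite /crosses /= eE //.
  by rewrite /letter_shift; case: s d {eE} => [] [] /=; split; lia.
elim: p j k => [|l p ih] j k; first by rewrite /word_shift big_nil addr0; split=> ->.
rewrite word_shift_cons addrA; split=> [[z /cE -> /ih ->//]|->].
by exists (j + letter_shift d l); [exact/cE|exact/ih].
Qed.

Lemma loop_line d i p : loop (line d i) p <-> word_shift d p = 0.
Proof.
rewrite /loop /line; case: d => /=.
  rewrite (@walk_shift true) /=; first by split; lia.
  by case.
rewrite (@walk_shift false) /=; first by split; lia.
by case=> j k /=; rewrite /letter_shift ?addr0.
Qed.

Lemma marked_line d i : marked (line d i).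
Proof.
case: d => s j; (split; [|]); case: s; rewrite /unique /=.
- by exists (j + 1); split => // k ->.
- by exists (j + 1); split => // k ->.
- by exists (j - 1); split => [|k]; lia.
- by exists (j - 1); split => [|k]; lia.
- by exists (j + 1); split => // k ->.
- by exists j; split => // k ->.
- by exists (j - 1); split => [|k]; lia.
- by exists j; split => // k ->.
Qed.

Lemma connected_line d i : graph_connected (line d i).
Proof.
suff h (G : pgraph) (f : int -> vertex G) :
    (forall j, edge lx0 (f j) (f (j + 1))) -> base G = f i ->
    forall j, exists n, in_ball n (f j).
  by case: d; [exact: (h (line_double i) id)|exact: (h (line_loops i) id)].
move=> fe fb; suff up k : in_ball k (f (i + k%:Z)) /\ in_ball k (f (i - k%:Z)).
  move=> j; exists `|j - i|%N; have [? ?] := up `|j - i|%N.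
  have [->|->] : j = i + `|j - i|%N%:Z \/ j = i - `|j - i|%N%:Z by lia.
    by rewrite (_ : `|_|%N = `|j - i|%N)//; lia.
  by rewrite (_ : `|_|%N = `|j - i|%N)//; lia.
elim: k => [|k [ih1 ih2]]; first by rewrite oppr0 !addr0 -fb; split.
split; right.
  exists (f (i + k%:Z)), lx0; split => //; left.
  by rewrite (_ : i + k.+1%:Z = i + k%:Z + 1)//; lia.
exists (f (i - k%:Z)), lx0; split => //; right.
by rewrite (_ : f (i - k%:Z) = f (i - k.+1%:Z + 1))//; congr f; lia.
Qed.

(** A word shorter than the distance to the grey vertex stays among the white
    vertices, or among the black ones, where the graph is a line. *)
Lemma run_far (T : bintree) p n (v : node T) : (size p < `|n|)%N ->
  run p (n, v) = (n - word_shift (0 < n) p, v).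
Proof.
elim: p n => [|l p ih] n pn; first by rewrite /word_shift big_nil subr0.
rewrite -[run _ _]/(run p (step l (n, v))).
have -> : step l (n, v) = (n - letter_shift (0 < n) l, v).
  case: l pn {ih} => [[] []] /=; rewrite /step /letter_shift /= ?opprK//;
  by case: n => [[|[|j]]|i] //= _; congr pair => /=; lia.
have ln : (0 < n - letter_shift (0 < n) l) = (0 < n).
  move: pn; case: l => [[] []] /=; rewrite /letter_shift /=; case: (ltP 0 n) => /=; lia.
rewrite ih; first by rewrite ln word_shift_cons; congr pair => /=; lia.
move: pn; case: l {ih ln} => [[] []] /=; rewrite /letter_shift /=;
  by case: (ltP 0 n) => /=; lia.
Qed.

Lemma loop_far (T : bintree) p n i (v : node T) : (size p < `|n|)%N ->
  loop (tree_graph (n, v)) p <-> loop (line (0 < n) i) p.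
Proof.
move=> pn; rewrite loop_run loop_line run_far//; split=> [[]|->]; first by lia.
by rewrite subr0.
Qed.

(** ** Ancestors *)

Section ancestors.
Variable T : bintree.
Implicit Type v : node T.

Definition ancestor (k : nat) v : node T := iter k (@parent T) v.

Lemma ancestorS k v : ancestor k.+1 v = ancestor k (parent v).
Proof. exact: iterSr. Qed.

Lemma ancestorD j k v : ancestor (j + k) v = ancestor j (ancestor k v).
Proof. exact: iterD. Qed.

Lemma run_to_ancestor k v :
  exists2 p, (size p <= k.*2)%N & run p (0, v) = (0, ancestor k v).
Proof.
elim: k v => [|k ih] v; first by exists [::].
have [p ps pv] := run_to_parent v; have [q qs qv] := ih (parent v).
exists (p ++ q); last by rewrite run_cat pv qv -ancestorS.
by rewrite size_cat ps; case: (side v) => /=; lia.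
Qed.

Lemma connected_ancestors (x : int * node T) :
  (forall v v', exists j k, ancestor j v = ancestor k v') ->
  graph_connected (tree_graph x).
Proof.
move=> h; apply: connected_tree_graph => v v'; have [j [k e]] := h v v'.
have [p _ pv] := run_to_ancestor j v; have [q _ qv] := run_to_ancestor k v'.
by exists (p ++ inv_word q); rewrite run_cat pv e; apply/run_inv.
Qed.

Fixpoint descend (p : seq bool) v : node T :=
  if p is b :: p' then child b (descend p' v) else v.

Lemma descend_cat p q v : descend (p ++ q) v = descend p (descend q v).
Proof. by elim: p => //= b p ->. Qed.

End ancestors.
Arguments ancestor : simpl never.

(** ** The trees of grey vertices of the graphs P(w) *)

Definition grey_child (w : nat -> bool) (b : bool) (v : grey) : grey :=
  if b then left_child w v else right_child w v.

Definition grey_parent (v : grey) : grey :=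
  match v with
  | grey_gS k => grey_gS k.+1
  | grey_d k [::] => grey_gS k.-1
  | grey_d k (_ :: p) => grey_d k p
  end.

Definition grey_side (w : nat -> bool) (v : grey) : bool :=
  match v with
  | grey_gS k => w k.+1
  | grey_d 0 [::] => w 0%N
  | grey_d k.+1 [::] => ~~ w k
  | grey_d k (b :: _) => b
  end.

Section grey_tree.
Variable w : nat -> bool.

Lemma grey_parent_child b v : grey_parent (grey_child w b v) = v.
Proof. by case: v b => [[|k]|k p] [] //=; case: (w _). Qed.

Lemma grey_side_child b v : grey_side w (grey_child w b v) = b.
Proof. by case: v b => [[|k]|[|k] p] [] //=; case E: (w _); rewrite /= ?E. Qed.

Lemma grey_child_parent v : grey_child w (grey_side w v) (grey_parent v) = v.
Proof.
by case: v => [k|[|k] [|[] p]]//=; rewrite /grey_child /=; case E: (w _); rewrite //= E.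
Qed.

Definition grey_tree : bintree :=
  BinTree grey_parent_child grey_side_child grey_child_parent.

Definition trunk_graph (n : int) : pgraph := @tree_graph grey_tree (n, grey_g 0).

Lemma grey_g_ancestor k : @ancestor grey_tree k (grey_g 0) = grey_g k.
Proof. by elim: k => //= k; rewrite /ancestor /= => ->; case: k. Qed.

Lemma grey_ancestor (v : grey) : exists k j, @ancestor grey_tree k v = grey_g j.
Proof.
case: v => [k|k p]; first by exists 0%N, k.+1.
exists (size p).+1, k.-1.+1; elim: p => // b p ih.
by rewrite /= ancestorS.
Qed.

Lemma connected_trunk_graph n : graph_connected (trunk_graph n).
Proof.
apply: connected_ancestors => v v'.
have [k [i vi]] := grey_ancestor v; have [k' [j vj]] := grey_ancestor v'.
exists (j + k)%N, (i + k')%N; rewrite !ancestorD vi vj.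
by rewrite -(grey_g_ancestor i) -(grey_g_ancestor j) -!ancestorD addnC.
Qed.

Definition position (q : Pvertex) : int * grey :=
  match q with
  | Grey v => (0, v)
  | white i v => (Posz i.+1, v)
  | black i v => (Negz i, v)
  end.

Definition vertex_at (x : int * grey) : Pvertex :=
  match x with
  | (Posz 0, v) => Grey v
  | (Posz i.+1, v) => white i v
  | (Negz i, v) => black i v
  end.

Lemma P_graph_tree_graph q :
  isomorphic (P_graph w q) (@tree_graph grey_tree (position q)).
Proof.
exists position; split => //.
  by exists vertex_at => [[v|i v|i v]|[[[|i]|i] v]].
have sE s x : Pedge w s x (vertex_at (@step grey_tree (s, true) (position x))).
  case: s x => [] [v|[|i] v|i v]; try exact: P0_grey; try exact: P0_white1;
    try exact: P1_white1; try exact: P1_grey; try exact: P1_black.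
  - exact: P0_white.
  - by rewrite /step /= addn0; exact: P0_black.
  - exact: P1_white.
have pK x : position (vertex_at x) = x by case: x => [[[|i]|i] v].
move=> s u v; split; last first.
  move=> /= e; have := sE s u; rewrite e.
  by have -> : vertex_at (position v) = v by case: v {e}.
have Pu z z' : Pedge w s u z -> Pedge w s u z' -> z = z'.
  by move=> h; inversion h; subst => h'; inversion h'; subst.
by move=> /= uv; rewrite (Pu _ _ uv (sE s u)) pK.
Qed.

(** The number of letters of [w] that have been read on the way to a vertex. *)
Definition level (v : grey) : nat :=
  match v with grey_gS k => k.+1 | grey_d k _ => k end.

Lemma level_step l (x : int * grey) :
  (level (@step grey_tree l x).2 <= (level x.2).+1)%N.
Proof.
have lc b v : (level (grey_child w b v) <= level v)%N.
  by case: v b => [[|k]|k p] [] //=; case: (w _) => /=.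
have lp v : (level (grey_parent v) <= (level v).+1)%N.
  by case: v => [k|[|k] [|b p]] /=.
case: x => n v; case: l n => [[] []] [[|[|i]]|i]; rewrite /step /= ?leqnSn//.
- exact: leq_trans (lc false v) _.
- exact: leq_trans (lc true v) _.
Qed.

Lemma level_run p (x : int * grey) :
  (level (@run grey_tree p x).2 <= level x.2 + size p)%N.
Proof.
elim: p x => [|l p ih] x; first by rewrite addn0.
apply: leq_trans (ih _) _; rewrite /= addnS -addSn leq_add2r; exact: level_step.
Qed.

(** All vertices seen by a word of length L lie below g_L, where they are
    addressed by finite sequences of sides. *)
Lemma grey_descend L (v : grey) : (level v <= L)%N ->
  exists p, v = @descend grey_tree p (grey_g L).
Proof.
have gL k : (k <= L)%N -> exists p, grey_g k = @descend grey_tree p (grey_g L).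
  move=> kL; rewrite -(subKn kL); elim: (L - k)%N (leq_subr k L) => [|i ih] iL.
    by exists [::]; rewrite subn0.
  have [|p pE] := ih; first exact: ltnW.
  exists (w (L - i.+1)%N :: p); rewrite /= -pE.
  have -> : (L - i)%N = (L - i.+1).+1 by lia.
  by rewrite /grey_child /=; case: (w (L - i.+1)%N).
case: v => [k|k p] /= kL; first exact: (gL k.+1).
have [q qE] : exists q, grey_d k [::] = @descend grey_tree q (grey_g L).
  case: k kL => [|k] kL; first exact: (gL 0%N).
  have [q qE] := gL _ kL; exists (~~ w k :: q); rewrite /= -qE.
  by rewrite /grey_child /=; case: (w k).
by exists (p ++ q); rewrite descend_cat -qE; elim: p => //= b p <-; case: b.
Qed.

End grey_tree.

Lemma step_agree w w' l (x : int * grey) :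
  (forall k, (k <= level x.2)%N -> w k = w' k) ->
  @step (grey_tree w) l x = @step (grey_tree w') l x.
Proof.
move=> ww; have cl : left_child w x.2 = left_child w' x.2.
  by case: x.2 ww => [k|k p] //= ->.
have cr : right_child w x.2 = right_child w' x.2.
  by case: x.2 ww => [k|k p] //= ->.
have sE : grey_side w x.2 = grey_side w' x.2.
  by case: x.2 ww => [k|[|k] [|c p]] //= ->.
case: l x cl cr sE {ww} => [[] []] [[[|[|i]]|i] v] //= cl cr sE;
  by rewrite /step /= /grey_child ?cl ?cr ?sE.
Qed.

(** Each letter of the word uncovers at most one letter of [w]. *)
Lemma run_agree w w' p (x : int * grey) :
  (forall k, (k < level x.2 + size p)%N -> w k = w' k) ->
  @run (grey_tree w) p x = @run (grey_tree w') p x.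
Proof.
elim: p x => // l p ih x ww.
rewrite -[LHS]/(@run (grey_tree w) p (@step (grey_tree w) l x)).
rewrite -[RHS]/(@run (grey_tree w') p (@step (grey_tree w') l x)).
rewrite -(@step_agree w w'); last by move=> k kx; apply: ww; rewrite /=; lia.
apply: ih => k kp; apply: ww; apply: leq_trans kp _ => /=.
by rewrite addnS -addSn leq_add2r; exact: level_step.
Qed.

Lemma loop_trunk_agree w w' n p :
  (forall k, (k < size p)%N -> w k = w' k) ->
  loop (trunk_graph w n) p <-> loop (trunk_graph w' n) p.
Proof. by move=> ww; rewrite !loop_run (@run_agree w w'). Qed.

(** ** Unfolding a tree from one of its vertices *)

Section unfolding.
Variables (T : bintree) (v : node T).

Definition ancestor_sides (k : nat) : bool := side (ancestor k v).

(** The graphs P(w) are universal: they map onto every graph over a tree, with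
    the sides of the successive ancestors of a vertex as the word [w]. *)
Definition unfold (x : grey) : node T :=
  match x with
  | grey_gS k => ancestor k.+1 v
  | grey_d 0 p => descend p v
  | grey_d k.+1 p => descend p (child (~~ ancestor_sides k) (ancestor k.+1 v))
  end.

Lemma unfold_g k : unfold (grey_g k) = ancestor k v.
Proof. by case: k. Qed.

Lemma unfold_morph : @is_tree_morph (grey_tree ancestor_sides) T unfold.
Proof.
move=> b [k|[|k] p]; rewrite /= /grey_child; [|by case: b..].
have cE : child (ancestor_sides k) (ancestor k.+1 v) = ancestor k v.
  exact: child_parent.
rewrite /=; case: b; case E: (ancestor_sides k); rewrite ?unfold_g -?cE ?E//=;
  by rewrite E.
Qed.

Lemma unfold_descend p k : unfold (@descend (grey_tree ancestor_sides) p (grey_g k)) =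
  descend p (ancestor k v).
Proof. by elim: p => [|b p ih]; rewrite /= ?unfold_g// unfold_morph ih. Qed.

(** A short word does not distinguish the graph from its unfolding, provided
    that it starts far from the grey vertices or that the tree has no
    coincidences below some old ancestor of [v]. *)
Lemma loop_unfold n p :
  (size p < `|n|)%N \/ injective (fun q => descend q (ancestor (size p) v)) ->
  loop (trunk_graph ancestor_sides n) p <-> loop (tree_graph (n, v)) p.
Proof.
case=> [pn|inj]; first by rewrite !(@loop_far _ _ _ 0).
rewrite !loop_run; set x := (n, grey_g 0).
pose y := @run (grey_tree ancestor_sides) p x; rewrite -/y.
have yE : run p (n, v) = (y.1, unfold y.2) := esym (move_run unfold_morph p x).
rewrite yE; split=> [->//|[y1 y2]]; rewrite [y]surjective_pairing y1.
have [q qE] : exists q, y.2 = @descend (grey_tree ancestor_sides) q (grey_g (size p)).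
  exact/grey_descend/(level_run ancestor_sides p x).
have [q' q'E] : exists q',
    grey_g 0 = @descend (grey_tree ancestor_sides) q' (grey_g (size p)).
  exact/grey_descend.
congr pair; rewrite qE q'E; congr descend; apply: inj.
by rewrite -!unfold_descend -qE -q'E y2.
Qed.

End unfolding.

(** ** The tree of finitely supported sequences *)

(** [Some s] is the sequence s 1 0 0 0 ... and [None] the zero sequence. *)
Definition tail : Type := option (seq bool).

Definition tail_child (b : bool) (u : tail) : tail :=
  match u with
  | None => if b then Some [::] else None
  | Some s => Some (b :: s)
  end.

Definition tail_parent (u : tail) : tail :=
  if u is Some (_ :: s) then Some s else None.

Definition tail_side (u : tail) : bool :=
  match u with
  | None => false
  | Some [::] => true
  | Some (b :: _) => b
  end.

Lemma tail_parent_child b u : tail_parent (tail_child b u) = u.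
Proof. by case: u b => [s|] []. Qed.

Lemma tail_side_child b u : tail_side (tail_child b u) = b.
Proof. by case: u b => [s|] []. Qed.

Lemma tail_child_parent u : tail_child (tail_side u) (tail_parent u) = u.
Proof. by case: u => [[|b s]|]. Qed.

Definition tail_tree : bintree :=
  BinTree tail_parent_child tail_side_child tail_child_parent.

Lemma tail_ancestor (u : tail) : exists k, @ancestor tail_tree k u = None.
Proof.
case: u => [s|]; last by exists 0%N.
by exists (size s).+1; elim: s => // b s ih; rewrite /= ancestorS.
Qed.

Lemma connected_tail_graph x : graph_connected (@tree_graph tail_tree x).
Proof.
apply: connected_ancestors => v v'.
have [k kv] := tail_ancestor v; have [k' kv'] := tail_ancestor v'.
by exists k, k'; rewrite kv kv'.
Qed.

Lemma tail_descend_Some p s : @descend tail_tree p (Some s) = Some (p ++ s).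
Proof. by elim: p => //= b p ->. Qed.

Lemma tail_descend_inj (u : tail) : u <> None ->
  injective (fun q => @descend tail_tree q u).
Proof.
case: u => // s _ p q; rewrite !tail_descend_Some => -[] e.
have /eqP : p ++ s == q ++ s by apply/eqP.
have sz : size p = size q.
  by move/(congr1 size): e; rewrite !size_cat => /addIn.
by move=> /eqP; rewrite eqseq_cat// => /andP[/eqP].
Qed.

(** The vertex (0, None), which is the point 1/2, is the only grey vertex with
    an [x1]-loop.  The black vertices have one as well: the second word excludes
    b_1(v), which it moves to b_1 of the left child of v, and the third word
    excludes the b_i(v) with i >= 2, since it fixes them. *)
Definition x1_word : word := [:: (lx1, true)].
Definition left_child_word : word :=
  [:: (lx0, false); (lx0, false); (lx1, true); (lx0, true)].
Definition conj_x1_word : word := [:: (lx0, false); (lx1, true); (lx0, true)].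

Lemma rootP (x : int * tail) :
  x = (0, None) <->
  [/\ @run tail_tree x1_word x = x, @run tail_tree left_child_word x = x &
      @run tail_tree conj_x1_word x <> x].
Proof.
split=> [->|] //; case: x => [[[|[|i]]|[|i]] [s|]] [] //=; rewrite /run /= /step /=.
- by move=> [] /(congr1 size) /=; lia.
- by move=> []; lia.
- by move=> []; lia.
- by move=> _ [] /(congr1 size) /=; lia.
- by move=> _ _ []; rewrite (_ : Negz i.+1 + 1 = Negz i) /=; [congr pair|]; lia.
- by move=> _ _ []; rewrite (_ : Negz i.+1 + 1 = Negz i) /=; [congr pair|]; lia.
Qed.

(** A walk leads the base vertex x to 1/2; conjugated by it, the words that
    characterize 1/2 show that the same walk leads y to 1/2. *)
Lemma tail_graph_rigid l (x y : int * tail) :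
  (`|x.1| <= l)%N -> @ancestor tail_tree l x.2 = None ->
  (forall p, (size p <= l * 6 + 4)%N ->
    loop (@tree_graph tail_tree x) p <-> loop (@tree_graph tail_tree y) p) ->
  x = y.
Proof.
case: x => n v /= nl vl xy.
have [p ps pv] := @run_to_grey tail_tree n v.
have [q qs qv] := @run_to_ancestor tail_tree l v.
have pq : @run tail_tree (p ++ q) (n, v) = (0, None) by rewrite run_cat pv qv vl.
have conj z r : loop (@tree_graph tail_tree z) ((p ++ q) ++ r ++ inv_word (p ++ q)) <->
    @run tail_tree r (@run tail_tree (p ++ q) z) = @run tail_tree (p ++ q) z.
  by rewrite loop_run !(run_cat (p ++ q)) (run_cat r) run_inv; split=> /esym.
have yq : @run tail_tree (p ++ q) y = (0, None).
  have E r : (size r <= 4)%N -> @run tail_tree r (0, None) = (0, None) <->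
      @run tail_tree r (@run tail_tree (p ++ q) y) = @run tail_tree (p ++ q) y.
    move=> rs; rewrite -conj -xy ?conj ?pq//.
    by rewrite !size_cat size_inv_word size_cat; lia.
  have [h1 h2 h3] := (rootP _).1 (erefl (0 : int, None : tail)).
  apply: (rootP _).2; split=> [||h]; [exact/(E x1_word)|exact/(E left_child_word)|].
  exact: h3 ((E conj_x1_word isT).2 h).
by move: pq yq => /run_inv <- /run_inv <-.
Qed.

(** * Coding the graphs of types B and C by the Cantor set *)

Section recognition.
Variable T : bintree.
Implicit Types (v : node T) (n j : int).

Definition x0_power (j : int) : word :=
  match j with Posz k => nseq k (lx0, true) | Negz k => nseq k.+1 (lx0, false) end.

Lemma run_x0_power j n v : run (x0_power j) (n, v) = (n - j, v).
Proof.
by case: j => k; rewrite ?run_x0// run_x0V; congr pair => /=; lia.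
Qed.

Definition position_word (j : int) : word :=
  x0_power j ++ (lx1, true) :: inv_word (x0_power j).

Definition parent_word (b : bool) : word :=
  if b then [:: (lx1, false); (lx0, true)] else [:: (lx1, false)].

Lemma run_parent_word v : run (parent_word (side v)) (0, v) = (0, parent v).
Proof. by case E: (side v); rewrite /run /= /step /= E. Qed.

Definition side_word : word :=
  [:: (lx1, false); (lx0, true); (lx1, true); (lx0, false); (lx1, true)].

Hypothesis child_neq : forall b v, child b v <> v.

(** The black vertices are those with an [x1]-loop. *)
Lemma run_position_word j n v :
  run (position_word j) (n, v) = (n, v) <-> n < j.
Proof.
rewrite /position_word run_cat run_x0_power.
rewrite -[run _ _]/(run (inv_word (x0_power j)) (step (lx1, true) (n - j, v))).
rewrite run_inv run_x0_power.
case: (leP j n) => nj; last first.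
  by rewrite (_ : n - j = Negz `|n - j|.-1); [split|lia].
split=> //; have -> : n - j = `|n - j|%N%:Z by lia.
case: `|n - j|%N => [|[|k]]; rewrite /step /= => -[] //; last by lia.
by move/esym/child_neq.
Qed.

(** From a right child of u, the word goes to u and to b_1(u), where [x1] is a
    loop, and comes back; from a left child of u it goes to a_1(u), to u and to
    the right child of u, and ends at the left child of the latter. *)
Lemma run_side_word v : run side_word (0, v) = (0, v) <-> side v = false.
Proof.
rewrite /side_word /run /= /step /=; case E: (side v) => /=; last first.
  by split=> // _; rewrite -{2}(child_parent v) E.
split=> // -[]; rewrite -[in RHS](child_parent v) E => /(congr1 (@parent T)).
by rewrite !parent_child => /child_neq.
Qed.

End recognition.

Lemma grey_child_neq w b (v : grey) : @child (grey_tree w) b v <> v.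
Proof.
case: v => [k|k p] /=.
  rewrite /grey_child /=; case: b; case: (w k) => //; case: k => //= k [];
  by lia.
by rewrite /grey_child; case: b => -[] /(congr1 size) /=; lia.
Qed.

(** The loops tell the position of the base vertex, then, going up the trunk
    from g_0, on which side of g_(k+1) the vertex g_k lies. *)
Lemma trunk_graph_inj w w' n n' :
  (forall p, loop (trunk_graph w n) p <-> loop (trunk_graph w' n') p) ->
  w = w' /\ n = n'.
Proof.
move=> ww.
have nn : n = n'.
  have nE j : (n < j) = (n' < j).
    have := ww (position_word j); rewrite !loop_run.
    rewrite !run_position_word; try exact: grey_child_neq.
    by move=> h; apply/idP/idP => /h.
  by move: (nE n) (nE n'); rewrite !ltxx; case: ltgtP.
subst n'; split => //; apply/funext => k.
pose reached j := exists2 p, @run (grey_tree w) p (n, grey_g 0) = (0, grey_g j) &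
  @run (grey_tree w') p (n, grey_g 0) = (0, grey_g j).
have letter_eq j : reached j -> w j = w' j.
  move=> [p pw pw'].
  have sE u : @run (grey_tree u) side_word (0, grey_g j) = (0, grey_g j) <-> u j = false.
    by rewrite run_side_word; [case: j {pw pw'}|exact: grey_child_neq].
  have {}sE u : (0, grey_g j) = @run (grey_tree u) side_word (0, grey_g j) <-> u j = false.
    by rewrite -sE; split=> /esym.
  have := ww (p ++ side_word ++ inv_word p).
  rewrite !loop_run !run_cat pw pw' !run_inv pw pw' !sE.
  by case: (w j) (w' j) => [] [] // [h1 h2]; [rewrite h2|rewrite h1].
apply: (letter_eq k); elim: k => [|k kr].
  exists (x0_power n);
    exact: (etrans (run_x0_power _ _ _) (congr1 (pair^~ _) (subrr n))).
have gS u : @run (grey_tree u) (parent_word (u k)) (0, grey_g k) = (0, grey_g k.+1).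
  have -> : u k = @side (grey_tree u) (grey_g k) by case: k {kr}.
  by rewrite run_parent_word; case: k {kr}.
have wk := letter_eq _ kr; have [p pw pw'] := kr.
by exists (p ++ parent_word (w k)); rewrite run_cat ?pw ?pw' ?gS// wk gS.
Qed.

Section coding.
Implicit Type c : nat -> bool.

(** The word c codes the sign c_0 of the position, then its size in unary: the
    number of letters 1 between c_0 and the next 0; the remaining letters form
    [w].  If no 0 occurs, the position is infinite and the graph is a line. *)
Definition ones c : option nat :=
  if pselect (exists i, ~~ c i.+1) is left h then Some (ex_minn h) else None.

Lemma onesP c :
  match ones c with
  | Some m => c m.+1 = false /\ (forall i, (i < m)%N -> c i.+1)
  | None => forall i, c i.+1
  end.
Proof.
rewrite /ones; case: pselect => [h|h].
  case: ex_minnP => m /negbTE cm mmin; split => // i im; apply/negPn/negP => /mmin.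
  by rewrite leqNgt im.
by move=> i; apply/negPn/negP => ci; apply: h; exists i.
Qed.

Lemma ones_some c m :
  c m.+1 = false -> (forall i, (i < m)%N -> c i.+1) -> ones c = Some m.
Proof.
move=> cm cl; have := onesP c; case: (ones c) => [k [ck kl]|/(_ m)]; last by rewrite cm.
congr Some; case: (ltngtP k m) => // [/cl|/kl]; first by rewrite ck.
by rewrite cm.
Qed.

Definition signed (b : bool) (m : nat) : int := if b then Posz m else Negz m.

Definition code_word c (m k : nat) : bool := c (m + k.+2)%N.

Definition code_graph c : pgraph :=
  if ones c is Some m then trunk_graph (code_word c m) (signed (c 0%N) m)
  else line (c 0%N) 0.

Lemma marked_code_graph c : marked (code_graph c).
Proof.
rewrite /code_graph; case: (ones c) => [m|]; last exact: marked_line.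
exact: marked_tree_graph.
Qed.

Lemma connected_code_graph c : graph_connected (code_graph c).
Proof.
rewrite /code_graph; case: (ones c) => [m|]; last exact: connected_line.
exact: connected_trunk_graph.
Qed.

Lemma code_graph_surj w b m : exists c, code_graph c = trunk_graph w (signed b m).
Proof.
pose c i := if i is j.+1 then if (j < m)%N then true else
  if j == m then false else w (j - m.+1)%N else b.
have cm : ones c = Some m by apply: ones_some => [|i im]; rewrite /= ?ltnn ?eqxx// im.
exists c; rewrite /code_graph cm; congr trunk_graph; apply/funext => k.
rewrite /code_word addnS /= (_ : (_ < m)%N = false); last by lia.
by rewrite (_ : (_ == m) = false); [congr w|]; lia.
Qed.

Lemma code_graph_line d : exists c, code_graph c = line d 0.
Proof.
pose c i := if i is j.+1 then true else d.
have cm : ones c = None by have := onesP c; case: (ones c) => // m [].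
by exists c; rewrite /code_graph cm.
Qed.

(** In a line the position is infinite: no power of [x0] crosses the boundary
    between loops and edges labelled [x1]. *)
Lemma line_position_word d j : loop (line d 0) (position_word j) <-> ~~ d.
Proof.
rewrite loop_line /position_word word_shift_cat word_shift_cons word_shift_inv.
by rewrite /letter_shift /=; case: d; split => //; lia.
Qed.

Lemma signed_inj b b' m m' : signed b m = signed b' m' -> b = b' /\ m = m'.
Proof. by case: b b' => [] [] //= []. Qed.

Lemma code_graph_inj c c' :
  (forall p, loop (code_graph c) p <-> loop (code_graph c') p) -> c = c'.
Proof.
have mixed w n d : ~ (forall p, loop (trunk_graph w n) p <-> loop (line d 0) p).
  move=> h; have E j : (n < j) = ~~ d.
    have := h (position_word j); rewrite loop_run line_position_word.
    by rewrite run_position_word ?h; [move=> e; apply/idP/idP => /e|exact: grey_child_neq].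
  by have := E n; rewrite ltxx -(E (n + 1)); lia.
rewrite /code_graph; have := onesP c; have := onesP c'.
case: (ones c') => [m'|]; case: (ones c) => [m|].
- move=> [c'm c'1] [cm c1] /trunk_graph_inj[ww /signed_inj[c0 mm]]; subst m'.
  apply/funext => -[//|i]; case: (ltngtP i m) => im; last by rewrite im cm c'm.
    by rewrite c1// c'1.
  move/(congr1 (fun w => w (i - m.+1)%N)): ww; rewrite /code_word.
  by rewrite (_ : (m + _)%N = i.+1)//; lia.
- move=> _ _ h.
  by case: (@mixed (code_word c' m') (signed (c' 0%N) m') (c 0%N)) => p; rewrite h.
- by move=> _ _ /mixed.
- move=> c'1 c1 h; have c0 : c 0%N = c' 0%N.
    have := h (position_word 0); rewrite !line_position_word.
    by case: (c 0%N) (c' 0%N) => [] [] // [h1 h2]; [have := h2 isT|have := h1 isT].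
  by apply/funext => -[//|i]; rewrite c1 c'1.
Qed.

(** This is the continuity of the coding.  If the position is finite, a code that
    begins in the same way has the same position and a word [w] with the same
    first letters; if it is infinite, such a code has a large position, and
    [loop_far] applies. *)
Lemma code_graph_loops c l : exists N, forall c',
  (forall i, (i < N)%N -> c' i = c i) -> forall p, (size p <= l)%N ->
  loop (code_graph c') p <-> loop (code_graph c) p.
Proof.
rewrite {2}/code_graph; have := onesP c; case: (ones c) => [m|] c1.
  exists (m + l.+2)%N => c' cc p pl.
  have c'm : ones c' = Some m.
    case: c1 => cm c1; apply: ones_some => [|i im]; rewrite cc ?cm ?c1//; lia.
  rewrite /code_graph c'm cc; last by lia.
  by apply: loop_trunk_agree => k kp; rewrite /code_word cc//; lia.
exists l.+2 => c' cc p pl; rewrite /code_graph -(cc 0%N)//.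
have := onesP c'; case: (ones c') => [m [c'm _]|//].
have ml : (l < m)%N by rewrite ltnNge; apply/negP => ml; move: c'm; rewrite cc ?c1.
rewrite (@loop_far _ _ _ 0); last by case: (c' 0%N) => /=; lia.
by rewrite (_ : (0 < signed (c' 0%N) m) = c' 0%N)//; case: (c' 0%N) => /=; lia.
Qed.

End coding.

(** * The graphs of types B and C form a Cantor set *)

Definition graph_class_of (G : pgraph) (mG : marked G) (cG : graph_connected G) :
  graph_class := GraphClass (ex_intro _ G (And3 mG cG erefl)).

Lemma members_graph_class_of G (mG : marked G) (cG : graph_connected G) :
  members (graph_class_of mG cG) G.
Proof. exact: isomorphic_refl. Qed.

Lemma members_isomorphic t G H : members t G -> isomorphic G H -> members t H.
Proof.
case: (membersP t) => K [_ _ ->] /= KG GH; exact: isomorphic_trans GH.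
Qed.

Lemma graph_class_ofP G (mG : marked G) (cG : graph_connected G) t :
  members t G <-> t = graph_class_of mG cG.
Proof.
split=> [tG|->]; last exact: members_graph_class_of.
exact: graph_class_eq tG (members_graph_class_of mG cG) (isomorphic_refl G).
Qed.

Lemma loops_graph_class_of G (mG : marked G) (cG : graph_connected G) p :
  loops_of (graph_class_of mG cG) p <-> loop G p.
Proof. exact/loops_ofE/members_graph_class_of. Qed.

Lemma trunk_graph_P w n : isomorphic (trunk_graph w n)
  (P_graph w (match n with Posz i => a_ i (grey_g 0) | Negz i => b_ i.+1 (grey_g 0) end)).
Proof.
apply: isomorphic_sym; case: n => [i|i]; last exact: P_graph_tree_graph.
by case: i => [|i]; exact: P_graph_tree_graph.
Qed.

Section cantor.
Variable R : realType.

Definition coded_graph (c : cantor_space) : marked_space R :=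
  graph_class_of (@marked_code_graph c) (@connected_code_graph c).

Lemma loops_coded_graph c p : loops_of (coded_graph c) p <-> loop (code_graph c) p.
Proof. exact: loops_graph_class_of. Qed.

Lemma coded_graph_inj : injective coded_graph.
Proof.
move=> c c' cc; apply: code_graph_inj => p.
by rewrite -!loops_coded_graph cc.
Qed.

Lemma cylinder_nbhs (c : cantor_space) N :
  nbhs c [set c' : cantor_space | forall i, (i < N)%N -> c' i = c i].
Proof.
elim: N => [|N ih]; first by apply: filterS filterT => c' _ i.
have cN : nbhs c [set c' : cantor_space | c' N = c N].
  exact: (@proj_continuous nat (fun=> bool) N c _ (discrete_set1 _)).
apply: filterS (filterI ih cN) => c' [/= h cN'] i.
by rewrite ltnS leq_eqVlt => /orP[/eqP ->//|/h].
Qed.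

Lemma coded_graph_continuous : continuous coded_graph.
Proof.
move=> c U /nbhs_same_loops[l lU].
have [N NP] := code_graph_loops c l.
apply: filterS (cylinder_nbhs c N) => c' /= cc; apply: lU => p pl.
by rewrite !loops_coded_graph NP.
Qed.

Lemma types_BC_coded : types_BC R = range coded_graph.
Proof.
have hit w b m : exists c, isomorphic (code_graph c) (trunk_graph w (signed b m)).
  have [c cE] := code_graph_surj w b m; exists c; rewrite cE; exact: isomorphic_refl.
have hitP c t G H : members t H -> isomorphic (code_graph c) G -> isomorphic G H ->
    range coded_graph t.
  move=> tH cG GH; exists c => //; apply/esym/graph_class_ofP.
  by apply: members_isomorphic tH _; apply/isomorphic_sym/(isomorphic_trans cG GH).
apply/seteqP; split => [t|t [c _ <-]].
  move=> [G [[w [n n0 Gn]]|[i Gi]] tG].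
    case: Gn => GE; rewrite GE in tG.
      have [c cP] := hit w true n.-1.
      exact: (hitP c t _ _ tG cP (trunk_graph_P w (Posz n.-1))).
    have [c cP] := hit w false n.-1; apply: (hitP c t _ _ tG cP).
    by rewrite -[n]prednK//; exact: (trunk_graph_P w (Negz n.-1)).
  have [d GE] : exists d, G = line d i by case: Gi => ->; [exists false|exists true].
  have [c cE] := code_graph_line d; exists c => //; apply: same_loops_eq => n p _.
  by rewrite loops_coded_graph (loops_ofE p tG) GE cE !loop_line.
have mc : members (coded_graph c) (code_graph c) by exact: members_graph_class_of.
move: mc; set u := coded_graph c; rewrite /code_graph; case: (ones c) => [m|] mc.
  have := members_isomorphic mc (trunk_graph_P _ _).
  set w := code_word c m; case: (c 0%N) => /= tG.
    exists (P_graph w (a_ m (grey_g 0))) => //; left; exists w, m.+1 => //; by left.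
  exists (P_graph w (b_ m.+1 (grey_g 0))) => //; left; exists w, m.+1 => //; by right.
exists (line (c 0%N) 0) => //; right; exists 0.
by case: (c 0%N); [right|left].
Qed.

Lemma types_BC_compact : compact (types_BC R).
Proof.
rewrite types_BC_coded; apply: continuous_compact cantor_space_compact.
by apply: continuous_subspaceT; exact: coded_graph_continuous.
Qed.

Lemma types_BC_closed : closed (types_BC R).
Proof. exact: compact_closed (@metric_hausdorff _ _) types_BC_compact. Qed.

(** The coding is a continuous bijection from a compact space to a Hausdorff
    space. *)
Lemma types_BC_homeomorphic : homeomorphic (set_type (types_BC R)) cantor_space.
Proof.
have codedP c : coded_graph c \in types_BC R.
  by rewrite types_BC_coded; apply/mem_set; exists c.
have dec (t : set_type (types_BC R)) : exists c, coded_graph c = set_val t.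
  have : types_BC R `<=` range coded_graph by rewrite types_BC_coded.
  by move=> /(_ _ (set_valP t))[c _ ct]; exists c.
have [f fP] := choice dec.
pose g c : set_type (types_BC R) := exist _ (coded_graph c) (codedP c).
exists f, g; split.
- by move=> t; apply: val_inj; rewrite /= fP.
- by move=> c; apply: coded_graph_inj; rewrite fP.
- apply/continuous_closedP => A cA.
  have -> : f @^-1` A = set_val @^-1` (coded_graph @` A).
    apply/seteqP; split => t /=; first by move=> At; exists (f t).
    by move=> [c Ac ct]; have <- : c = f t; [apply: coded_graph_inj; rewrite fP|].
  have := @initial_continuous (set_type (types_BC R)) (marked_space R) set_val.
  move=> /continuous_closedP; apply.
  apply: compact_closed; first exact: metric_hausdorff.
  apply: continuous_compact; last exact: subclosed_compact cA cantor_space_compact _.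
  by apply: continuous_subspaceT; exact: coded_graph_continuous.
- by apply: continuous_comp_initial => c; exact: coded_graph_continuous.
Qed.

Lemma types_BC_no_isolated : isolated (types_BC R) = set0.
Proof.
rewrite types_BC_coded -subset0 => t [/set_mem[c _ <-] [V cV VE]].
have : limit_point [set: cantor_space] c by have [_ ->] := cantor_perfect.
move=> /(_ (coded_graph @^-1` V)) [|c' [c'c _ Vc']].
  exact: coded_graph_continuous.
have : [set coded_graph c] (coded_graph c') by rewrite -VE; split => //; exists c'.
by move=> /coded_graph_inj e; rewrite e eqxx in c'c.
Qed.

End cantor.

(** * The Schreier graph is the graph over the tree of finite sequences *)

Section schreier.
Variable R : realType.
Implicit Types (x y r : R).

Lemma dyadic_int (m : int) : dyadic (m%:~R : R).
Proof. by exists m, 0%N; rewrite expr0 divr1. Qed.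

Lemma dyadicD x y : dyadic x -> dyadic y -> dyadic (x + y).
Proof.
move=> [m [i ->]] [n [j ->]]; exists (m * 2 ^+ j + n * 2 ^+ i), (i + j)%N.
have e2 k : (2 : R) ^+ k != 0 by rewrite expf_neq0// pnatr_eq0.
have := e2 i; have := e2 j; rewrite exprD rmorphD !rmorphM !rmorphXn /=.
by move=> ej ei; field; rewrite ei ej.
Qed.

Lemma dyadicM x y : dyadic x -> dyadic y -> dyadic (x * y).
Proof.
move=> [m [i ->]] [n [j ->]]; exists (m * n), (i + j)%N.
by rewrite rmorphM exprD /= mulrACA -invfM.
Qed.

Lemma dyadic_expz (k : int) : dyadic (2 ^ k : R).
Proof.
case: k => k; last by exists 1, k.+1; rewrite div1r.
by have := dyadic_int (2 ^+ k); rewrite rmorphXn.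
Qed.

Lemma dyadicB x y : dyadic x -> dyadic y -> dyadic (x - y).
Proof.
move=> dx dy; rewrite -mulN1r; apply: dyadicD => //; apply: dyadicM => //.
exact: (dyadic_int (-1)).
Qed.

Lemma dyadic_half x : dyadic x -> dyadic (x / 2).
Proof. by move=> dx; apply: dyadicM => //; exact: (dyadic_expz (-1)). Qed.

(** Induction on the exponent of the denominator: 2x - m has a smaller one than
    x, and m is chosen so as to stay in the interval under consideration. *)
Lemma dyadic_ind (P : R -> Prop) :
  (forall m : int, P m%:~R) ->
  (forall x, (forall m : int, P (2 * x - m%:~R)) -> P x) ->
  forall x, dyadic x -> P x.
Proof.
move=> P0 PS x [m [n ->]]; elim: n m => [|n ih] m; first by rewrite expr0 divr1.
apply: PS => k; have := ih (m - k * 2 ^+ n).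
suff -> : (m - k * 2 ^+ n)%:~R / 2 ^+ n = 2 * (m%:~R / 2 ^+ n.+1) - k%:~R :> R by [].
have e2 : (2 : R) ^+ n != 0 by rewrite expf_neq0// pnatr_eq0.
by rewrite rmorphB rmorphM rmorphXn /= exprS; field.
Qed.

(** The number with binary expansion 0.u. *)
Definition tail_val (u : tail) : R :=
  if u is Some s then foldr (fun (b : bool) x => (b%:R + x) / 2) (1 / 2) s else 0.

Lemma tail_val_child b (u : tail) : tail_val (tail_child b u) = (b%:R + tail_val u) / 2.
Proof. by case: u b => [s|] [] //=; rewrite ?addr0 ?mul0r. Qed.

Lemma tail_val_itv (u : tail) : 0 <= tail_val u < 1.
Proof.
case: u => [s|] /=; last by lra.
by elim: s => [|[] s /andP[ih1 ih2]] /=; lra.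
Qed.

Lemma tail_val_gt0 s : 0 < tail_val (Some s).
Proof. by elim: s => [|[] s] /=; lra. Qed.

Lemma tail_val_inj : injective tail_val.
Proof.
have sideE (u : tail) : tail_val u = ((tail_side u)%:R + tail_val (tail_parent u)) / 2.
  by rewrite -tail_val_child tail_child_parent.
have inj0 (u : tail) : tail_val u = 0 -> u = None.
  by case: u => // s; have := tail_val_gt0 s => /[swap] ->; rewrite ltxx.
have sideP (u v : tail) : tail_val u = tail_val v ->
    tail_side u = tail_side v /\ tail_val (tail_parent u) = tail_val (tail_parent v).
  rewrite (sideE u) (sideE v) => e.
  have := tail_val_itv (tail_parent u); have := tail_val_itv (tail_parent v).
  by case: (tail_side u) (tail_side v) e => [] [] /=; split => //; lra.
move=> [s|] v; last by move=> /esym/inj0.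
elim: s v => [|b s ih] v /sideP[sv pv]; rewrite -(tail_child_parent v) -sv.
  by rewrite (inj0 _ (esym pv)).
by rewrite -(ih _ pv).
Qed.

Lemma tail_val_dyadic u : dyadic (tail_val u).
Proof.
case: u => [s|] /=; last exact: (dyadic_int 0).
elim: s => [|b s ih] /=; apply: dyadic_half; first exact: (dyadic_int 1).
by apply: dyadicD => //; exact: (dyadic_int b%:Z).
Qed.

Lemma tail_val_surj r : dyadic r -> 0 <= r < 1 -> exists u, tail_val u = r.
Proof.
move: r; apply: dyadic_ind => [m|r ih] r01.
  exists None; have /andP[m0 m1] := r01.
  by rewrite /= (_ : m = 0)//; move: m0 m1; rewrite ler0z ltrz1; lia.
have [r2|r2] := ltP r (1 / 2).
  have [|u uE] := ih 0; first by rewrite subr0; lra.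
  by exists (tail_child false u); rewrite tail_val_child uE /=; lra.
have [|u uE] := ih 1; first by lra.
by exists (tail_child true u); rewrite tail_val_child uE /=; lra.
Qed.

(** The vertex a_i(v) is the point with binary expansion 0.1...10v with i + 1
    digits 1 in front, and b_i(v) is the point 0.0...01v with i digits 0. *)
Definition point (x : int * tail) : R :=
  match x.1 with
  | Posz i => iter i (fun y => (1 + y) / 2) (1 / 2 + tail_val x.2 / 4)
  | Negz i => iter i (fun y => y / 2) ((1 + tail_val x.2) / 4)
  end.

Lemma point_pos i u : 1 / 2 <= point (Posz i, u) < 1.
Proof.
rewrite /point /=; have := tail_val_itv u.
by elim: i => [|i ih] /=; [|move=> /ih]; lra.
Qed.

Lemma point_neg i u : 0 < point (Negz i, u) < 1 / 2.
Proof.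
rewrite /point /=; have := tail_val_itv u.
by elim: i => [|i ih] /=; [|move=> /ih]; lra.
Qed.

Lemma point_itv (x : int * tail) : 0 < point x < 1.
Proof.
by case: x => [[i|i] u]; [have := point_pos i u|have := point_neg i u]; lra.
Qed.

Lemma pointS i u : point (Posz i.+1, u) = (1 + point (Posz i, u)) / 2.
Proof. by []. Qed.

Lemma pointNS i u : point (Negz i.+1, u) = point (Negz i, u) / 2.
Proof. by []. Qed.

Lemma point_inj : injective point.
Proof.
have pos i j u v : point (Posz i, u) = point (Posz j, v) -> i = j /\ u = v.
  elim: i j => [|i ih] [|j].
  - rewrite /point /= => e; split => //; apply: tail_val_inj; lra.
  - move=> e; exfalso; move: e (point_pos j v) (tail_val_itv u).
    by rewrite pointS /point /=; lra.
  - move=> e; exfalso; move: e (point_pos i u) (tail_val_itv v).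
    by rewrite pointS /point /=; lra.
  - rewrite !pointS => e; have [|-> ->//] := ih j; lra.
have neg i j u v : point (Negz i, u) = point (Negz j, v) -> i = j /\ u = v.
  elim: i j => [|i ih] [|j].
  - rewrite /point /= => e; split => //; apply: tail_val_inj; lra.
  - move=> e; exfalso; move: e (point_neg j v) (tail_val_itv u).
    by rewrite pointNS /point /=; lra.
  - move=> e; exfalso; move: e (point_neg i u) (tail_val_itv v).
    by rewrite pointNS /point /=; lra.
  - rewrite !pointNS => e; have [|-> ->//] := ih j; lra.
case=> [[i|i] u] [[j|j] v].
- by move=> /pos[-> ->].
- by move=> e; exfalso; move: e (point_pos i u) (point_neg j v); lra.
- by move=> e; exfalso; move: e (point_neg i u) (point_pos j v); lra.
- by move=> /neg[-> ->].
Qed.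

Lemma point_dyadic (x : int * tail) : dyadic (point x).
Proof.
have d1 := dyadic_int 1.
case: x => [[i|i] u]; rewrite /point /=; elim: i => [|i ih].
- apply: dyadicD; first exact: dyadic_half.
  rewrite (_ : _ / 4 = tail_val u / 2 / 2); last by lra.
  by do 2 apply: dyadic_half; exact: tail_val_dyadic.
- by apply/dyadic_half/dyadicD.
- rewrite /= (_ : _ / 4 = (1 + tail_val u) / 2 / 2); last by lra.
  by do 2 apply: dyadic_half; apply: dyadicD => //; exact: tail_val_dyadic.
- exact: dyadic_half.
Qed.

Lemma point_surj y : dyadic y -> 0 < y < 1 -> exists x : int * tail, point x = y.
Proof.
move=> dy; move: (dy); move: y dy; apply: dyadic_ind => [m|y ih] dy y01.
  by move: y01; rewrite ltr0z ltrz1; lia.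
have d1 := dyadic_int 1.
have dB (m : int) : dyadic (2 * y - m%:~R).
  apply: dyadicB; last exact: dyadic_int.
  by apply: dyadicM => //; exact: (dyadic_int 2).
have d4 (m : int) : dyadic (4 * y - m%:~R).
  apply: dyadicB; last exact: dyadic_int.
  by apply: dyadicM => //; exact: (dyadic_int 4).
have [y3|y3] := leP (3 / 4) y.
  have [|[[i|i] u] xE] := ih 1 (dB 1); first by lra.
    by exists (Posz i.+1, u); rewrite pointS xE; lra.
  by have := point_neg i u; rewrite xE; lra.
have [y1|y1] := ltP y (1 / 4).
  have [|[[i|i] u] xE] := ih 0 (dB 0); first by rewrite subr0; lra.
    by have := point_pos i u; rewrite xE subr0; lra.
  by exists (Negz i.+1, u); rewrite pointNS xE; lra.
have [y2|y2] := leP (1 / 2) y.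
  have [|u uE] := @tail_val_surj (4 * y - 2%:~R) (d4 2); first by lra.
  by exists (Posz 0, u); rewrite /point /= uE; lra.
have [|u uE] := @tail_val_surj (4 * y - 1%:~R) (d4 1); first by lra.
by exists (Negz 0, u); rewrite /point /= uE; lra.
Qed.

Lemma act_point s (x : int * tail) : act s (point x) = point (@step tail_tree (s, true) x).
Proof.
case: x => n u; have u01 := tail_val_itv u.
case: s n => [] [[|[|i]]|i]; rewrite /step /act ?[(_, _).1]/= ?[(_, _).2]/=.
- by rewrite /x0 /point /=; case: leP => ?; [|case: leP => ?]; lra.
- by rewrite /x0 pointS subrr /point /=; case: leP => ?; [|case: leP => ?]; lra.
- rewrite (_ : Posz i.+2 - 1 = Posz i.+1)//.
  by have pi := point_pos i u; rewrite /x0 !pointS; case: leP => ?; [|case: leP => ?]; lra.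
- rewrite (_ : Negz i - 1 = Negz i.+1); last by lia.
  by have pi := point_neg i u; rewrite /x0 pointNS; case: leP => ?; [|case: leP => ?]; lra.
- rewrite /x1 /point /= tail_val_child /=.
  by case: leP => ?; [|case: leP => ?; [|case: leP => ?]]; lra.
- rewrite /x1 /point /= tail_val_child /=.
  by case: leP => ?; [|case: leP => ?; [|case: leP => ?]]; lra.
- have pi := point_pos i u; rewrite /x1 !pointS.
  by case: leP => ?; [|case: leP => ?; [|case: leP => ?]]; lra.
- have pi := point_neg i u; rewrite /x1.
  by case: leP => ?; [|case: leP => ?; [|case: leP => ?]]; lra.
Qed.

End schreier.

(** * The orbit of 1/2 under Thompson's group *)

Section orbit.
Variable R : realType.
Implicit Types (f : R -> R) (a b c x y : R) (l s : seq R).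

Definition linear_on f a b : Prop :=
  exists m k : R, forall x, a <= x <= b -> f x = m * x + k.

(** To compute a derivative that is known to exist, some arbitrarily short
    difference quotients are enough. *)
Lemma derivable_slope f x m : derivable f x 1 ->
  (forall d, 0 < d -> exists h, 0 < `|h| < d /\ f (h + x) - f x = m * h) ->
  f^`()%classic x = m.
Proof.
move=> df hm; apply/eqP; rewrite -subr_eq0 -normr_le0; apply/ler_addgt0Pl => e e0.
have : (fun h => h^-1 *: (f (h + x) - f x)) @ 0^' --> f^`()%classic x.
  rewrite derive1E; move: df; rewrite /derivable /derive /=.
  by under eq_fun do rewrite [_%:A]mulr1.
move=> /cvgrPdist_lt/(_ e e0); rewrite /dnbhs /within /= => /nbhs_ballP[d /= d0 dP].
have [h [/andP[h0 hd] hE]] := hm d d0.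
have hn0 : h != 0 by rewrite -normr_gt0.
have := dP h _ hn0; rewrite /ball /= sub0r normrN => /(_ hd).
by rewrite hE /GRing.scale /= mulrCA mulVf// mulr1 addr0 => /ltW.
Qed.

Lemma slope_right f a b m k : derivable f a 1 -> a < b ->
  (forall x, a <= x <= b -> f x = m * x + k) -> f^`()%classic a = m.
Proof.
move=> df ab fE; apply: derivable_slope => // d d0.
pose h := Num.min d (b - a) / 2.
have h0 : 0 < Num.min d (b - a) by rewrite lt_min d0 subr_gt0.
have [hd hb] : Num.min d (b - a) <= d /\ Num.min d (b - a) <= b - a.
  by split; rewrite ge_min lexx ?orbT.
exists h; split; first by rewrite gtr0_norm /h; lra.
by rewrite !fE /h; [ring|lra|lra].
Qed.

Lemma slope_left f a b m k : derivable f b 1 -> a < b ->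
  (forall x, a <= x <= b -> f x = m * x + k) -> f^`()%classic b = m.
Proof.
move=> df ab fE; apply: derivable_slope => // d d0.
pose h := - (Num.min d (b - a) / 2).
have h0 : 0 < Num.min d (b - a) by rewrite lt_min d0 subr_gt0.
have [hd hb] : Num.min d (b - a) <= d /\ Num.min d (b - a) <= b - a.
  by split; rewrite ge_min lexx ?orbT.
exists h; split; first by rewrite normrN gtr0_norm; lra.
by rewrite !fE /h; [ring|lra|lra].
Qed.

Lemma linear_on_glue f a b c : a < c -> c < b -> derivable f c 1 ->
  linear_on f a c -> linear_on f c b -> linear_on f a b.
Proof.
move=> ac cb df [m [k fE]] [m' [k' fE']].
have mm : m = m' by rewrite -(slope_left df ac fE) (slope_right df cb fE').
subst m'; exists m, k => x xab; have [xc|cx] := leP x c; first by apply: fE; lra.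
have kk : k = k' by have := fE c; have := fE' c; rewrite !lexx !ltW// => -> // /(_ isT); lra.
by rewrite fE' ?kk//; lra.
Qed.

Definition linear_off f s : Prop :=
  forall a b, 0 <= a -> a < b -> b <= 1 ->
    (forall c, c \in s -> ~ (a < c < b)) -> linear_on f a b.

(** Where the function is derivable, the slopes on both sides of a breakpoint
    agree and the breakpoint can be dropped.  Thus the breakpoints of an element
    of F may be taken dyadic. *)
Lemma linear_off_derivable f s s' :
  (forall x, 0 < x < 1 -> x \notin s' -> derivable f x 1) ->
  linear_off f s -> linear_off f s'.
Proof.
move=> df fs; have {fs} : linear_off f (s ++ s').
  by move=> a b a0 ab b1 h; apply: fs => // c cs; apply: h; rewrite mem_cat cs.
elim: s => // c s ih fs; apply: ih => a b a0 ab b1 h.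
have [/andP[ac cb]|acb] := boolP (a < c < b); last first.
  by apply: fs => // c'; rewrite inE => /orP[/eqP ->|/h//]; exact/negP.
have cs' : c \notin s' by apply/negP => cs'; apply: (h c); rewrite ?mem_cat ?cs' ?orbT ?ac.
have off a' b' : 0 <= a' -> a' < b' -> b' <= 1 -> a <= a' -> b' <= b ->
    ~ (a' < c < b') -> linear_on f a' b'.
  move=> a'0 ab' b'1 aa bb h'; apply: fs => // d; rewrite inE => /orP[/eqP ->//|/h dab dab'].
  by apply: dab; lra.
apply: (@linear_on_glue _ _ _ c) => //; first by apply: df => //; lra.
- by apply: off; rewrite ?ltxx ?andbF//; lra.
- by apply: off; rewrite ?ltxx//; lra.
Qed.

(** Between dyadic breakpoints the value changes by a power of 2 times a dyadic
    length; the induction is on the breakpoints between a and b. *)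
Lemma dyadic_values f s : linear_off f s -> (forall c, c \in s -> dyadic c) ->
  (forall x, 0 < x < 1 -> x \notin s ->
     derivable f x 1 /\ exists k : int, f^`()%classic x = 2 ^ k) ->
  forall a b, 0 <= a -> a < b -> b <= 1 -> dyadic a -> dyadic b ->
    dyadic (f a) -> dyadic (f b).
Proof.
move=> fs ds df.
suff h l a b : 0 <= a -> a < b -> b <= 1 -> dyadic a -> dyadic b -> dyadic (f a) ->
    (forall c, c \in s -> a < c < b -> c \in l) -> dyadic (f b).
  by move=> a b a0 ab b1 da db dfa; apply: (h s a b) => //.
elim: l a b => [|c l ih] a b a0 ab b1 da db dfa lP.
  have noc c : c \in s -> ~ a < c < b by move=> cs /(lP _ cs).
  have [m [k fE]] := fs a b a0 ab b1 noc.
  pose x := (a + b) / 2; have xs : x \notin s.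
    by apply/negP => /noc; apply; rewrite /x; lra.
  have [|dx [j jE]] := df x _ xs; first by rewrite /x; lra.
  have xb : x < b by rewrite /x; lra.
  have mE : m = 2 ^ j.
    rewrite -jE; apply/esym/(slope_right dx xb) => y xy; apply: fE; move: xy; rewrite /x; lra.
  have -> : f b = f a + m * (b - a) by rewrite !fE; [ring|lra|lra].
  by rewrite mE; apply: dyadicD => //; apply: dyadicM; [exact: dyadic_expz|exact: dyadicB].
have [/andP[cs /andP[ac cb]]|acb] := boolP ((c \in s) && (a < c < b)); last first.
  apply: (ih a b) => // c' c's c'ab; have := lP _ c's c'ab; rewrite inE => /orP[/eqP cc|//].
  by move: acb; rewrite -cc c's c'ab.
have dc := ds _ cs.
have dfc : dyadic (f c).
  apply: (ih a c) => //; first by lra.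
  move=> c' c's /andP[ac' c'c]; have := lP _ c's; rewrite ac' (lt_trans c'c cb) inE.
  by rewrite (lt_eqF c'c); apply.
apply: (ih c b) => //; first by lra.
move=> c' c's /andP[cc' c'b]; have := lP _ c's; rewrite c'b (lt_trans ac cc') inE.
by rewrite (gt_eqF cc'); apply.
Qed.

Lemma thompsonF_half f : thompsonF f -> dyadic (f (1 / 2)) /\ 0 < f (1 / 2) < 1.
Proof.
move=> [[[f01 _ fsurj] _] fmono [s fs] [s' [ds df]]].
have in01 x : (0 <= x <= 1) = (x \in `[0, 1]) by rewrite in_itv.
have fitv x : 0 <= x <= 1 -> 0 <= f x <= 1.
  by move=> x01; have := f01 x; rewrite /= !in_itv /=; apply.
have mono x y : 0 <= x -> x < y -> y <= 1 -> f x < f y.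
  by move=> x0 xy y1; apply: fmono => //; rewrite -in01; lra.
have f0 : f 0 = 0.
  have [|x /= + fx0] := fsurj 0; first by rewrite /= in_itv /= lexx ler01.
  rewrite in_itv /= => x01; have [x0|x0] := ltP 0 x.
    have := mono 0 x (lexx 0) x0; have := fitv 0; rewrite lexx ler01 => /(_ isT); lra.
  by rewrite -[in RHS]fx0; congr f; lra.
have f1 : 0 < f (1 / 2) < 1.
  have := mono 0 (1 / 2); have := mono (1 / 2) 1; have := fitv 1.
  by rewrite f0 lexx ler01 => /(_ isT) ? h1 h2; have := h1 _ _ _; have := h2 _ _ _; lra.
split => //; have fs' : linear_off f s'.
  by apply: (linear_off_derivable _ fs) => x x01 xs'; have [] := df x x01 xs'.
apply: (dyadic_values fs' ds df (a := 0)) => //; try lra.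
- exact: (dyadic_int R 0).
- exact/dyadic_half/(dyadic_int R 1).
- by rewrite f0; exact: (dyadic_int R 0).
Qed.

End orbit.

Section bend.
Variable R : realType.
Implicit Types (a b c m k x y : R).

Lemma pow2_below y : 0 < y < 2 -> exists j : nat, (2 : R) ^- j <= y < 2 * 2 ^- j.
Proof.
move=> /andP[y0 y2]; have ex : exists n, 2 ^- n <= y.
  by have [n ny] := exp2N_lt y0; exists n; exact: ltW.
case: (ex_minnP ex) => j jy jmin; exists j; rewrite jy /=.
case: j jy jmin => [|j] jy jmin; first by rewrite expr0 invr1 mulr1.
rewrite exprS invfM mulrA divff ?mul1r ?pnatr_eq0// ltNge; apply/negP => /jmin.
by rewrite ltnn.
Qed.

Definition ramp c x : R := Num.max 0 (x - c).

Lemma ramp_left c x : x <= c -> ramp c x = 0.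
Proof. by move=> xc; apply/max_idPl; lra. Qed.

Lemma ramp_right c x : c <= x -> ramp c x = x - c.
Proof. by move=> xc; apply/max_idPr; lra. Qed.

Lemma ramp_continuous c : continuous (ramp c).
Proof.
move=> x; apply: (@continuous_max _ _ (fun=> 0) (fun x => x - c)); first exact: cvg_cst.
by apply: cvgB; [exact: cvg_id|exact: cvg_cst].
Qed.

Lemma ramp_linear c a b : ~ (a < c < b) -> linear_on (ramp c) a b.
Proof.
move=> acb; have [ca|ac] := leP c a.
  by exists 1, (- c) => x xab; rewrite ramp_right ?mul1r//; lra.
have bc : b <= c by rewrite leNgt; apply/negP => cb; apply: acb; rewrite ac.
by exists 0, 0 => x xab; rewrite ramp_left ?mul0r ?addr0//; lra.
Qed.

Lemma locally_linear_derive (f : R -> R) a b m k x : a < x < b ->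
  (forall y, a < y < b -> f y = m * y + k) ->
  derivable f x 1 /\ f^`()%classic x = m.
Proof.
move=> xab fE; have nE : \near x, m * x + k = f x.
  have : \near x, x \in `]a, b[ by apply: near_in_itvoo; rewrite in_itv.
  by apply: filterS => y; rewrite in_itv /= => yab; rewrite fE.
have D : is_derive x (1 : R) ((m \*: (@id R)) \+ cst k) (m *: 1 + 0).
  exact: is_deriveD.
split; first by apply: near_eq_derivable nE _; exact: ex_derive.
rewrite derive1E -(near_eq_derive _ nE) [LHS](@derive_val _ _ _ _ _ _ _ D).
by rewrite addr0; exact: mulr1.
Qed.

(** Both [0,1/2] and [1/2,1] are bent at one point, so as to map them onto
    [0,y] and [y,1] by two slopes in the ratio 2: the slope p near 0 satisfies
    p <= 2 y < 2 p, and c is the point where the slope has to double; the slope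
    q near 1 and the point c' are found in the same way from 1 - y. *)
Lemma thompsonF_transitive y : dyadic y -> 0 < y < 1 ->
  exists2 f : R -> R, thompsonF f & f (1 / 2) = y.
Proof.
move=> dy y01.
have [|j /andP[pl pu]] := pow2_below (y := 2 * y); first by lra.
have [|i /andP[ql qu]] := pow2_below (y := 2 * (1 - y)); first by lra.
pose p : R := 2 ^- j; pose q : R := 2 ^- i; rewrite -/p -/q in pl pu ql qu.
have p0 : 0 < p by rewrite invr_gt0 exprn_gt0.
have q0 : 0 < q by rewrite invr_gt0 exprn_gt0.
pose c := 1 - y * 2 ^+ j; pose c' := (1 - y) * 2 ^+ i.
have pc : p * c = p - y.
  by rewrite /c mulrBr mulr1 mulrCA mulVf ?mulr1// expf_neq0// pnatr_eq0.
have qc : q * c' = 1 - y.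
  by rewrite /c' mulrCA mulVf ?mulr1// expf_neq0// pnatr_eq0.
have c0 : 0 < c by rewrite -(pmulr_rgt0 _ p0); lra.
have c12 : c <= 1 / 2 by rewrite -(ler_pM2l p0); lra.
have c'12 : 1 / 2 <= c' by rewrite -(ler_pM2l q0); lra.
have c'1 : c' < 1 by rewrite -(ltr_pM2l q0); lra.
have d1 := dyadic_int R 1.
have dp n : dyadic ((2 : R) ^+ n) by exact: (dyadic_expz R n%:Z).
have dc : dyadic c by apply: dyadicB => //; apply: dyadicM.
have dc' : dyadic c' by apply: dyadicM => //; exact: dyadicB.
have pE : p = 2 ^ (- j%:Z) by rewrite -exprnN.
have qE : q = 2 ^ (- i%:Z) by rewrite -exprnN.
have p2E : 2 * p = 2 ^ (1 - j%:Z) by rewrite expfzDr ?pnatr_eq0// -pE expr1z.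
have q2E : 2 * q = 2 ^ (1 - i%:Z) by rewrite expfzDr ?pnatr_eq0// -qE expr1z.
clearbody c c' p q.
pose f x := p * x + p * ramp c x + (2 * q - 2 * p) * ramp (1 / 2) x - q * ramp c' x.
have fl x : x <= 1 / 2 -> f x = p * x + p * ramp c x.
  by move=> x12; rewrite /f (ramp_left x12) (@ramp_left c') ?mulr0 ?addr0 ?subr0//; lra.
have fr x : 1 / 2 <= x -> f x = y + 2 * q * (x - 1 / 2) - q * ramp c' x.
  move=> x12; rewrite /f (ramp_right x12) (@ramp_right c); last by lra.
  by rewrite (mulrBr p) pc; field.
have ramp_homo b x x' : x <= x' -> ramp b x <= ramp b x'.
  by move=> xx; rewrite ge_max le_max lexx /= le_max lerD2r xx orbT.
have ramp_lip b x x' : x <= x' -> ramp b x' - ramp b x <= x' - x.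
  move=> xx; have [bx|/ltW bx] := leP b x; first by rewrite !ramp_right//; lra.
  rewrite (ramp_left bx) subr0; have [bx'|/ltW bx'] := leP b x'.
    by rewrite ramp_right//; lra.
  by rewrite ramp_left//; lra.
have fl_mono x x' : x < x' -> x' <= 1 / 2 -> f x < f x'.
  move=> xx x'12; rewrite !fl//; last by lra.
  by apply: ltr_leD; rewrite ?(ltr_pM2l p0)// ler_pM2l// ramp_homo// ltW.
have fr_mono x x' : x < x' -> 1 / 2 <= x -> f x < f x'.
  move=> xx x12; rewrite !fr//; last by lra.
  have : q * (ramp c' x' - ramp c' x) <= q * (x' - x) by rewrite ler_pM2l// ramp_lip// ltW.
  have : 0 < q * (x' - x) by rewrite mulr_gt0// subr_gt0.
  by lra.
have mono x x' : x < x' -> f x < f x'.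
  move=> xx; have [x'2|x'2] := leP x' (1 / 2); first exact: fl_mono.
  have [x2|x2] := leP (1 / 2) x; first exact: fr_mono.
  by apply: (lt_trans (fl_mono _ _ x2 _)) => //; exact: fr_mono.
have f0 : f 0 = 0 by rewrite fl ?mulr0 ?ramp_left ?mulr0 ?addr0//; lra.
have f1 : f 1 = 1 by rewrite fr ?ramp_right ?mulrBr ?qc; lra.
have fhalf : f (1 / 2) = y by rewrite fr// subrr mulr0 addr0 ramp_left ?mulr0 ?subr0.
have fc : continuous f.
  move=> x; have rc b : {for x, continuous (ramp b)} by exact: ramp_continuous.
  apply: cvgB; last by apply: cvgM; [exact: cvg_cst|exact: rc].
  apply: cvgD; last by apply: cvgM; [exact: cvg_cst|exact: rc].
  apply: cvgD; last by apply: cvgM; [exact: cvg_cst|exact: rc].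
  by apply: cvgM; [exact: cvg_cst|exact: cvg_id].
have monoW x x' : x <= x' -> f x <= f x'.
  by rewrite le_eqVlt => /orP[/eqP ->//|/mono/ltW].
pose s : seq R := [:: c; 1 / 2; c'].
exists f => //; split.
- split; last exact: continuous_subspaceT.
  split.
  + move=> x; rewrite /= !in_itv /= => /andP[x0 x1].
    by rewrite -{1}f0 -f1 !monoW.
  + move=> x x' _ _ e; case: (ltgtP x x') => // /mono; rewrite e ltxx//.
  + move=> z; rewrite /= in_itv /= => z01.
    have [|||x x01 xz] := @IVT R f 0 1 z.
    * exact: ler01.
    * exact: continuous_subspaceT.
    * by rewrite f0 f1 /Num.min /Num.max ltr01.
    by exists x.
- by move=> x x' _ _; exact: mono.
- exists s => a b a0 ab b1 h.
  have [m1 [k1 E1]] := ramp_linear (h c (mem_head _ _)).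
  have [m2 [k2 E2]] : linear_on (ramp (1 / 2)) a b.
    by apply/ramp_linear/h; rewrite !inE eqxx orbT.
  have [m3 [k3 E3]] : linear_on (ramp c') a b.
    by apply/ramp_linear/h; rewrite !inE eqxx !orbT.
  exists (p + p * m1 + (2 * q - 2 * p) * m2 - q * m3),
    (p * k1 + (2 * q - 2 * p) * k2 - q * k3) => x xab.
  by rewrite /f E1// E2// E3//; ring.
- exists s; split.
    move=> x; rewrite !inE => /or3P[] /eqP -> //; exact: dyadic_half.
  move=> x x01; rewrite !inE !negb_or => /and3P[xc x2 xc'].
  have [xc0|xc0|e] := ltgtP x c; last by rewrite e eqxx in xc.
    have [||dx ->] := @locally_linear_derive f 0 c p 0 x;
      [by lra| |by split=> //; exists (- j%:Z)].
    by move=> t tc; rewrite fl ?ramp_left ?mulr0//; lra.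
  have [x20|x20|e] := ltgtP x (1 / 2); last by rewrite e eqxx in x2.
    have [||dx ->] := @locally_linear_derive f c (1 / 2) (2 * p) (y - p) x;
      [by lra| |by split=> //; exists (1 - j%:Z)].
    by move=> t tc; rewrite fl ?ramp_right ?mulrBr ?pc; lra.
  have [xc'0|xc'0|e] := ltgtP x c'; last by rewrite e eqxx in xc'.
    have [||dx ->] := @locally_linear_derive f (1 / 2) c' (2 * q) (y - q) x;
      [by lra| |by split=> //; exists (1 - i%:Z)].
    by move=> t tc; rewrite fr ?ramp_left ?mulr0 ?subr0; lra.
  have [||dx ->] := @locally_linear_derive f c' 1 q (1 - q) x;
    [by lra| |by split=> //; exists (- i%:Z)].
  by move=> t tc; rewrite fr ?ramp_right ?mulrBr ?qc; lra.
Qed.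

Lemma orbit_halfE y : orbit_half R y <-> dyadic y /\ 0 < y < 1.
Proof.
split=> [[f fF <-]|[dy y01]]; first exact: thompsonF_half.
exact: thompsonF_transitive.
Qed.

End bend.

Section schreier_graph.
Variable R : realType.

Lemma orbit_point (x : int * tail) : orbit_half R (point R x).
Proof. by apply/orbit_halfE; split; [exact: point_dyadic|exact: point_itv]. Qed.

Definition schreier_vertex (x : int * tail) : {y : R | orbit_half R y} :=
  exist _ (point R x) (orbit_point x).

Lemma schreier_vertex_bij : bijective schreier_vertex.
Proof.
have inj : injective schreier_vertex by move=> x x' [] /point_inj.
have sur (v : {y : R | orbit_half R y}) : exists x, schreier_vertex x = v.
  have /orbit_halfE[dv v01] := proj2_sig v.
  by have [x xE] := point_surj dv v01; exists x; exact: sval_inj.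
have [g gP] := choice sur.
by exists g => // x; apply: inj; rewrite gP.
Qed.

Lemma schreier_tail_graph x :
  isomorphic (@tree_graph tail_tree x) (schreier (schreier_vertex x)).
Proof.
exists schreier_vertex; split => //; first exact: schreier_vertex_bij.
by move=> s u v /=; rewrite act_point; split=> [->//|/point_inj].
Qed.

Lemma schreier_setE (t : marked_space R) :
  schreier_set R t <-> exists x, members t (@tree_graph tail_tree x).
Proof.
split=> [[q tq]|[x tx]].
  have [g _ gK] := schreier_vertex_bij; exists (g q).
  apply: members_isomorphic tq (isomorphic_sym _); rewrite -[q in schreier q]gK.
  exact: schreier_tail_graph.
by exists (schreier_vertex x); apply: members_isomorphic tx _; exact: schreier_tail_graph.
Qed.

End schreier_graph.

(** * The closure of the set of pointed Schreier graphs *)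

Section closure.
Variable R : realType.
Implicit Types t u : marked_space R.

Let C : set (marked_space R) := schreier_set R.
Let D : set (marked_space R) := types_BC R.

Lemma trunk_types_BC t w n : members t (trunk_graph w n) -> D t.
Proof.
move=> tw; have [b [m nE]] : exists b m, n = signed b m.
  by case: n {tw} => m; [exists true, m|exists false, m].
have [c cE] := code_graph_surj w b m.
rewrite /D types_BC_coded; exists c => //; apply/esym/graph_class_ofP.
by rewrite cE -nE.
Qed.

Lemma tail_ancestor_None k : @ancestor tail_tree k None = None.
Proof. by elim: k => // k ih; rewrite ancestorS. Qed.

Lemma tail_ancestor_le j k (u : tail) : (j <= k)%N ->
  @ancestor tail_tree j u = None -> @ancestor tail_tree k u = None.
Proof. by move=> /subnK <- e; rewrite ancestorD e tail_ancestor_None. Qed.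

(** A Schreier graph whose base vertex is far from 1/2 looks like a graph of
    type B around it. *)
Lemma schreier_near_BC t (x : int * tail) l : members t (@tree_graph tail_tree x) ->
  (l < `|x.1|)%N \/ @ancestor tail_tree l x.2 <> None ->
  exists2 u, D u & same_loops l t u.
Proof.
case: x => n v tx far; pose w := @ancestor_sides tail_tree v.
pose u : marked_space R := graph_class_of (@marked_tree_graph (grey_tree w) (n, grey_g 0))
  (@connected_trunk_graph w n).
exists u; first exact: trunk_types_BC (members_graph_class_of _ _).
move=> p pl; rewrite (loops_ofE p tx) loops_graph_class_of; symmetry.
apply: loop_unfold; case: far => /= [ln|vl]; [left; exact: leq_ltn_trans ln|right].
by apply: tail_descend_inj => /(tail_ancestor_le pl).
Qed.

Lemma tail_ancestor_Some k s : (k <= size s)%N ->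
  @ancestor tail_tree k (Some s) = Some (drop k s).
Proof.
elim: k s => [|k ih] s; first by rewrite drop0.
by case: s => // b s ks; rewrite ancestorS /= ih.
Qed.

Lemma ancestor_sides_Some k s : (k < size s)%N ->
  @ancestor_sides tail_tree (Some s) k = nth false s k.
Proof.
by move=> ks; rewrite /ancestor_sides tail_ancestor_Some ?(ltnW ks)// (drop_nth false ks).
Qed.

(** Conversely P(w) is approximated by the sequences that begin like [w], and
    the lines by the graphs P(w) with a base vertex far from the trunk. *)
Lemma types_BC_sub_closure : D `<=` closure C.
Proof.
move=> t; rewrite /D types_BC_coded => -[c _ <-]; apply/closure_same_loops => l.
have [w [n cE]] : exists w n, forall p, (size p <= l)%N ->
    loop (code_graph c) p <-> loop (trunk_graph w n) p.
  rewrite /code_graph; case: (ones c) => [m|].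
    by exists (code_word c m), (signed (c 0%N) m).
  exists (fun=> false), (signed (c 0%N) l.+1) => p pl; symmetry.
  rewrite (@loop_far _ _ _ 0); last by case: (c 0%N) => /=; lia.
  by rewrite (_ : (0 < signed _ _) = c 0%N)//; case: (c 0%N) => /=; lia.
pose v : tail := Some (mkseq w l).
exists (graph_class_of (@marked_tree_graph tail_tree (n, v)) (@connected_tail_graph (n, v))).
  by apply/schreier_setE; exists (n, v); exact: members_graph_class_of.
move=> p pl; rewrite loops_coded_graph loops_graph_class_of cE//.
rewrite -(@loop_unfold tail_tree).
  apply: loop_trunk_agree => k kp; have kl := leq_trans kp pl.
  by rewrite ancestor_sides_Some ?size_mkseq// nth_mkseq.
by right; apply: tail_descend_inj; rewrite tail_ancestor_Some// size_mkseq.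
Qed.

Lemma schreier_rigid t : C t ->
  exists n, forall u, C u -> same_loops n t u -> t = u.
Proof.
move=> /schreier_setE[x tx]; have [k xk] := tail_ancestor x.2.
pose l := maxn `|x.1|%N k; exists (l * 6 + 4)%N => u /schreier_setE[y uy] tu.
apply: (graph_class_eq tx uy).
suff -> : x = y by exact: isomorphic_refl.
apply: (@tail_graph_rigid l); first exact: leq_maxl.
  exact: tail_ancestor_le (leq_maxr _ _) xk.
by move=> p pl; rewrite -(loops_ofE p tx) -(loops_ofE p uy); exact: tu.
Qed.

(** A limit of Schreier graphs that is not a limit of graphs of type B or C is
    a limit of graphs whose base vertex stays near 1/2; by rigidity these
    Schreier graphs do not vary. *)
Lemma closure_schreier : closure C = C `|` D.
Proof.
apply/seteqP; split=> [t Ct|t [Ct|/types_BC_sub_closure//]]; last exact: subset_closure.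
have [Dt|tD] := pselect (closure D t); first by right; exact: types_BC_closed.
left; have [l lD] : exists l, forall u, D u -> ~ same_loops l t u.
  apply: contrapT => h; apply: tD; apply/closure_same_loops => l.
  apply: contrapT => h'; apply: h; exists l => u Du tu; apply: h'; by exists u.
have tC := (closure_same_loops C t).1 Ct.
have [u Cu tu] := tC (maxn l (l * 6 + 4)).
suff -> : t = u by [].
have /schreier_setE[x ux] := Cu.
have not_far : ~ ((l < `|x.1|)%N \/ @ancestor tail_tree l x.2 <> None).
  move=> /(schreier_near_BC ux)[u' Du' uu']; apply: (lD _ Du').
  by apply: same_loops_trans uu'; apply: same_loops_le tu; exact: leq_maxl.
have xl : (`|x.1| <= l)%N by rewrite leqNgt; apply/negP => ?; apply: not_far; left.
have vl : @ancestor tail_tree l x.2 = None.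
  by apply: contrapT => ?; apply: not_far; right.
apply: same_loops_eq => n; pose N := maxn n (l * 6 + 4)%N.
have [u' Cu' tu'] := tC N; suff -> : u = u' by apply: same_loops_le tu'; exact: leq_maxl.
have /schreier_setE[y uy] := Cu'; apply: (graph_class_eq ux uy).
suff -> : x = y by exact: isomorphic_refl.
apply: (tail_graph_rigid xl vl) => p pl; rewrite -(loops_ofE p ux) -(loops_ofE p uy).
apply: (@same_loops_trans (l * 6 + 4) u t u') => //.
  by apply: same_loops_sym; apply: same_loops_le tu; exact: leq_maxr.
by apply: same_loops_le tu'; exact: leq_maxr.
Qed.

Lemma types_BC_not_isolated t : D t -> ~ isolated (closure C) t.
Proof.
move=> Dt [_ [V tV VE]]; suff : isolated D t by rewrite types_BC_no_isolated.
split; first exact: mem_set.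
exists V => //; apply/seteqP; split=> [u [Vu Du]|u ->].
  by rewrite -VE; split => //; exact: types_BC_sub_closure.
by split => //; exact: nbhs_singleton.
Qed.

(** Rigidity isolates a Schreier graph among the Schreier graphs, hence also
    among their limits. *)
Lemma isolated_closure_schreier : isolated (closure C) = C.
Proof.
apply/seteqP; split=> [t it|t Ct].
  by have := isolatedS it; rewrite closure_schreier => -[//|/types_BC_not_isolated].
split; first by apply/mem_set/subset_closure.
have [n nt] := schreier_rigid Ct.
exists [set u | same_loops n t u]; first by apply/nbhs_same_loops; exists n.
apply/seteqP; split=> [u /= [tu /closure_same_loops uC]|u ->]; last first.
  by split; [move=> p|exact: subset_closure].
apply: same_loops_eq => m; have [u' Cu' uu'] := uC (maxn m n).
have -> : t = u'.
  apply: nt => //; apply: same_loops_trans tu _; apply: same_loops_le uu'; exact: leq_maxr.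
by apply: same_loops_le uu'; exact: leq_maxl.
Qed.

Lemma CB_derivative_closure_schreier : CB_derivative (closure C) = D.
Proof.
rewrite /CB_derivative isolated_closure_schreier {1}closure_schreier.
apply/seteqP; split=> [t [[//|//]]|t Dt]; split; first by right.
by move=> Ct; apply: (types_BC_not_isolated Dt); rewrite isolated_closure_schreier.
Qed.

Lemma schreier_set_nonempty : C !=set0.
Proof.
exists (graph_class_of (@marked_tree_graph tail_tree (0, None))
  (@connected_tail_graph (0, None))).
by apply/schreier_setE; exists (0, None); exact: members_graph_class_of.
Qed.

End closure.

Theorem proposition4p2 (R : realType) :
  [/\ has_CB_rank (closure (schreier_set R)) 1,
      is_perfect_kernel (closure (schreier_set R)) (types_BC R) &
      homeomorphic (set_type (types_BC R)) cantor_space].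
Proof.
have rank1 : has_CB_rank (closure (schreier_set R)) 1.
  split=> [|m].
    rewrite /no_isolated_point /= CB_derivative_closure_schreier.
    exact: types_BC_no_isolated.
  rewrite ltnS leqn0 => /eqP ->; rewrite /no_isolated_point /= isolated_closure_schreier.
  by have [t Ct] := schreier_set_nonempty R => C0; rewrite C0 in Ct.
split => //; last exact: types_BC_homeomorphic.
by exists 1%N => //=; rewrite CB_derivative_closure_schreier.
Qed.
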